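(* Let $(X,\mu)$ be a measure space with a (separable) doubling ball-basis $\mathscr B$, let $1\le r<\infty$, let $\{T_\alpha\}$ be a family of uniformly restricted bounded oscillation operators $T_\alpha:L^r(X,\mathbb U)\to L^0(X,\mathbb V)$, let $Tf=\sup_\alpha\|T_\alpha f\|_{\mathbb V}$, and assume $C(T)=\mathcal L_0(T)+\sup_\alpha\mathcal L_1(T_\alpha)<\infty$. Then for any $f\in L^r(X,\mathbb U)$ and a ball $B$ the maximal operator $T$ satisfies $$\mu\{x\in B:\ |Tf(x)-m_{T(f)}(B)|>t\,\mathcal M_\#f(x)\}\lesssim\exp(-ct)\,\mu(B),\qquad t>0,$$ where $m_{T(f)}(B)$ is a median of $T(f)$ on $B$, $\mathcal M_\#f(x)=\sup_{B\in\mathscr B,\,B\ni x}\langle f\rangle_{\#,B}$ is the sharp maximal function, and $c>0$ is a constant.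
   Context: Ball-basis. Let $(X,\mathfrak M,\mu)$ be a measure space. A family $\mathscr B$ of measurable sets (balls) is a ball-basis if: (B1) $0<\mu(B)<\infty$ for $B\in\mathscr B$; (B2) any two points lie in a common ball; (B3) for any $E\in\mathfrak M$, $\varepsilon>0$ there is a finite or infinite sequence of balls $B_k$ with $\mu(E\triangle\bigcup_kB_k)<\varepsilon$; (B4) for any $B\in\mathscr B$ there is a ball $[B]\in\mathscr B$ with $B^*:=\bigcup_{A\in\mathscr B:\ \mu(A)\le2\mu(B),\ A\cap B\ne\varnothing}A\subset[B]$ and $\mu([B])\le\mathcal K\mu(B)$, $\mathcal K$ independent of $B$. All ball-bases are assumed separable (arbitrary unions of balls are measurable). $\mathscr B$ is doubling if there is $\eta>1$ such that for every ball $B$ with $B^*\ne X$ there is a ball $B'\supsetneq B$ with $\mu(B')\le\eta\mu(B)$. Notation. $\mathbb U,\mathbb V$ are Banach spaces; $L^0(X,\mathbb V)$ is the space of measurable $\mathbb V$-valued functions. $\langle f\rangle_A=\big(\frac1{\mu(A)}\int_A\|f\|_{\mathbb U}^r\big)^{1/r}$, $\langle f\rangle_A^*=\sup_{C\in\mathscr B,C\supset A}\langle f\rangle_C$, $f_B=\frac1{\mu(B)}\int_Bf$, $\langle f\rangle_{\#,B}=\big(\frac1{\mu(B)}\int_B\|f-f_B\|_{\mathbb U}^r\big)^{1/r}$. $\mathrm{OSC}_E(g)=\operatorname{esssup}_{x,x'\in E}\|g(x)-g(x')\|$, $\mathrm{SUP}_E(g)=\operatorname{esssup}_{x\in E}\|g(x)\|$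 (norm of the space of values), $\mathrm{OSC}_{B,\beta}(g)=\inf_{E\subset B:\,\mu(E)>\beta\mu(B)}\mathrm{OSC}_E(g)$ for $0<\beta<1$. BO operators (with parameters $\varrho=\rho=1/r$). A sublinear $S:L^r(X,\mathbb U)\to L^0(X,\mathbb V)$ (i.e. $\|S(f+g)\|_{\mathbb V}\le\|Sf\|_{\mathbb V}+\|Sg\|_{\mathbb V}$) is a bounded oscillation (BO) operator if there are constants $\mathcal L_j(S)$ such that, whenever $f\in L^r(X,\mathbb U)$: (T0) for $B\in\mathscr B$, $\lambda>0$: $\mu\{x\in B:\|S(f\mathbf 1_B)(x)\|_{\mathbb V}>\lambda\langle f\rangle_B\}\le(\mathcal L_0/\lambda)^{r}\mu(B)$; (T1) for $B\in\mathscr B$: $\mathrm{OSC}_B(S(f\mathbf 1_{X\setminus B^*}))\le\mathcal L_1\langle f\rangle^*_B$; (T2) for every ball $A$ with $A^*\ne X$ there is a ball $B\supsetneq A$ with $\mathrm{SUP}_A(S(f\mathbf 1_{B^*\setminus A^*}))\le\mathcal L_2\langle f\rangle_{B^*}$. Restricted type. A BO operator $S$ is of restricted type if: (R1) $\mathscr B$ is doubling; (R2) $S$ is linear; (R3) $S$ satisfies (T0) with $\varrho=\rho=1/r$; (R4) there is a constant $\mathcal L_1(S)$ such that for any ball $B$, $\mathrm{OSC}_B(S(f\mathbf 1_{X\setminus B^*}))\le\mathcal L_1(S)\sup_{A\in\mathscr B:A\supset B}\log^{-1}\big(1+\frac{\mu(A)}{\mu(B)}\big)\langle f\rangle_A$;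 (R5) for any ball $B$ and $\varepsilon>0$ there is a ball $B'\supset B$ such that for any ball $B''\supset B'$ it holds $\mathrm{OSC}_B(S(\mathbf 1_{B''}))\le\varepsilon$. A family of restricted type operators is uniformly restricted if (R3)–(R5) are satisfied uniformly. $\mathcal L_1(T_\alpha)$ is the constant in (R4) and $\mathcal L_0(T)$ the constant in (T0) for the maximal operator $T$. Median. Let $M_g(B)\subset B$ be the union of all measurable $E\subset B$ with $\mu(E)>\mu(B)/2$ and $\mathrm{OSC}_E(g)\le2\,\mathrm{OSC}_{B,1/2}(g)$; $m$ is a median of $g$ on $B$ if there is a point $x\in M_g(B)$ with $g(x)=m$. $a\lesssim b$ means $a\le c'b$ with an admissible constant $c'>0$, i.e. one depending only on $\mathcal K,\eta,r$.
   Formalization: In the median's M_g(B) the bound OSC_E(g) ≤ 2 OSC_{B,1/2}(g) is taken pointwise on E (with the essential oscillation any value of g could be a median); sup_α is the supremum in L^0, modulo null sets; (R5) for U-valued functions uses u·1_{B''}, u in U. *)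

(* Defs.v *)
From HB Require Import structures.
From mathcomp Require Import all_boot all_order all_algebra.
From mathcomp Require Import all_classical all_reals all_analysis.

Set Implicit Arguments.
Unset Strict Implicit.
Unset Printing Implicit Defensive.

Import Order.TTheory GRing.Theory Num.Theory.
Import numFieldNormedType.Exports.

Local Open Scope classical_set_scope.
Local Open Scope ring_scope.

Section ball_basis.
Context {R : realType} {d : measure_display} {X : measurableType d}.
Variables (mu : {measure set X -> \bar R}) (balls : set (set X)).
Implicit Types A B : set X.

Definition ball_star B : set X :=
  \bigcup_(A in [set A | [/\ balls A, (mu A <= 2%:E * mu B)%E
                            & A `&` B !=set0]]) A.

(* In B3, a finite (possibly empty) or infinite sequence of balls is a
   countable family. The last clause is separability. *)
Record ball_basis (K : R) : Prop := BallBasis {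
  B1_measurable : forall B, balls B -> measurable B;
  B1_gt0 : forall B, balls B -> (0 < mu B)%E;
  B1_fin : forall B, balls B -> (mu B < +oo)%E;
  B2 : forall x y : X, exists2 B, balls B & B x /\ B y;
  B3 : forall (E : set X) (e : R), measurable E -> 0 < e ->
    exists F : set (set X), [/\ countable F, F `<=` balls
      & (mu (E `+` \bigcup_(B in F) B) < e%:E)%E];
  B4 : forall B, balls B -> exists B',
    [/\ balls B', ball_star B `<=` B' & (mu B' <= K%:E * mu B)%E];
  ball_separable : forall F : set (set X), F `<=` balls ->
    measurable (\bigcup_(B in F) B) }.

Definition doubling (eta : R) : Prop := forall B, balls B ->
  ball_star B <> setT ->
  exists B', [/\ balls B', B `<` B' & (mu B' <= eta%:E * mu B)%E].

End ball_basis.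

Section vector_valued.
Context {R : realType} {d : measure_display} {X : measurableType d}.
Variable mu : {measure set X -> \bar R}.
Implicit Types (A B D E : set X).

Definition vsimple {V : normedModType R} (s : X -> V) : Prop :=
  finite_set (range s) /\ forall v, measurable (s @^-1` [set v]).

(* Representatives of the elements of L^0(X, V): strongly measurable functions *)
Definition smeasurable {V : normedModType R} (f : X -> V) : Prop :=
  exists s : nat -> X -> V,
    (forall n, vsimple (s n)) /\ (forall x, s ^~ x @ \oo --> f x).

Definition Lr {V : normedModType R} (r : R) (f : X -> V) : Prop :=
  smeasurable f /\ (\int[mu]_x (`|f x| `^ r)%:E < +oo)%E.

Definition simple_integral {V : normedModType R} D (s : X -> V) : V :=
  \sum_(v \in range s) fine (mu (D `&` s @^-1` [set v])) *: v.

Definition is_bochner {V : normedModType R} D (f : X -> V) (v : V) : Prop :=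
  exists s : nat -> X -> V,
    [/\ forall n, vsimple (s n),
        forall n, (mu (D `&` [set x | s n x != 0%R]) < +oo)%E,
        (fun n => (\int[mu]_(x in D) `|f x - s n x|%:E)%E) @ \oo --> 0%E
      & (fun n => simple_integral D (s n)) @ \oo --> v].

Definition bochner {V : normedModType R} D (f : X -> V) : V :=
  get (is_bochner D f).

Definition restr {V : normedModType R} (f : X -> V) D : X -> V :=
  fun x => \1_D x *: f x.

Definition avg {V : normedModType R} (r : R) (f : X -> V) A : \bar R :=
  (((fine (mu A))^-1%:E * \int[mu]_(x in A) (`|f x| `^ r)%:E) `^ r^-1)%E.

Definition mean {V : normedModType R} (f : X -> V) B : V :=
  (fine (mu B))^-1 *: bochner B f.

Definition sharp_avg {V : normedModType R} (r : R) (f : X -> V) B : \bar R :=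
  avg r (fun x => f x - mean f B) B.

Definition SUP {V : normedModType R} E (g : X -> V) : \bar R :=
  ereal_inf [set y | \forall x \ae mu, E x -> (`|g x|%:E <= y)%E].

(* The essential supremum over pairs: the points of a null set are discarded. *)
Definition OSC {V : normedModType R} E (g : X -> V) : \bar R :=
  ereal_inf [set y | exists2 N, mu.-negligible N &
    forall x x', (E `\` N) x -> (E `\` N) x' -> (`|g x - g x'|%:E <= y)%E].

Definition OSC_beta {V : normedModType R} (beta : R) B (g : X -> V) : \bar R :=
  ereal_inf [set OSC E g | E in
    [set E | [/\ measurable E, E `<=` B & (beta%:E * mu B < mu E)%E]]].

(* The oscillation of g on E is taken here without discarding null sets: with
   OSC E g instead, any point of a null singleton of B could be added to an
   admissible E, and then every value of g on B could be a median. The bound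
   OSC_beta still is the essential one. *)
Definition median_set {V : normedModType R} (g : X -> V) B : set X :=
  \bigcup_(E in [set E | [/\ measurable E, E `<=` B,
      (2^-1%:E * mu B < mu E)%E
    & forall x x', E x -> E x' ->
        (`|g x - g x'|%:E <= 2%:E * OSC_beta 2^-1 B g)%E]]) E.

Definition is_median {V : normedModType R} (g : X -> V) B (m : V) : Prop :=
  exists2 x, median_set g B x & g x = m.

(* The supremum of a family in L^0(X, R), i.e. modulo null sets; for a countable
   family this is the pointwise supremum, see pointwise_sup_is_L0_sup. *)
Definition is_L0_sup {I : Type} (u : I -> X -> R) (h : X -> R) : Prop :=
  [/\ measurable_fun setT h,
      forall i, \forall x \ae mu, u i x <= h x
    & forall k : X -> R, measurable_fun setT k ->
        (forall i, \forall x \ae mu, u i x <= k x) ->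
        \forall x \ae mu, h x <= k x].

Lemma pointwise_sup_is_L0_sup (u : nat -> X -> R) (h : X -> R) :
  measurable_fun setT h ->
  (forall x, ereal_sup [set (u i x)%:E | i in setT] = (h x)%:E) ->
  is_L0_sup u h.
Proof.
move=> mh uh; split=> // [i|k _ uk].
  by apply/nearW => x; rewrite -lee_fin -uh; apply: ereal_sup_ubound; exists i.
have := ae_foralln uk; apply: filterS => x ukx.
by rewrite -lee_fin -uh; apply: ge_ereal_sup => _ [i _ <-]; rewrite lee_fin.
Qed.

End vector_valued.

Section operators.
Context {R : realType} {d : measure_display} {X : measurableType d}.
Variables (mu : {measure set X -> \bar R}) (balls : set (set X)) (r : R).
Context {U V : normedModType R}.
Implicit Types (S : (X -> U) -> X -> V) (L : R).

Local Notation star := (ball_star mu balls).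

(* S maps L^r(X, U), a space of classes modulo null sets, to L^0(X, V);
   its values outside Lr mu r are irrelevant. *)
Definition is_operator S : Prop :=
  (forall f, Lr mu r f -> smeasurable (S f)) /\
  (forall f g, Lr mu r f -> Lr mu r g ->
    (\forall x \ae mu, f x = g x) -> \forall x \ae mu, S f x = S g x).

Definition sublinear S : Prop := forall f g, Lr mu r f -> Lr mu r g ->
  \forall x \ae mu, `|S (f \+ g) x| <= `|S f x| + `|S g x|.

Definition linear_operator S : Prop :=
  forall (a : R) f g, Lr mu r f -> Lr mu r g ->
  \forall x \ae mu, S (fun y => a *: f y + g y) x = a *: S f x + S g x.

Definition avg_star (f : X -> U) (B : set X) : \bar R :=
  ereal_sup [set avg mu r f C | C in [set C | balls C /\ B `<=` C]].

Definition T0 (L0 : R) S : Prop := 0 <= L0 /\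
  forall f, Lr mu r f -> forall B, balls B -> forall l : R, 0 < l ->
  (mu [set x | B x /\ (l%:E * avg mu r f B < `|S (restr f B) x|%:E)%E]
     <= ((L0 / l) `^ r)%:E * mu B)%E.

Definition T1 (L1 : R) S : Prop :=
  forall f, Lr mu r f -> forall B, balls B ->
  (OSC mu B (S (restr f (~` star B))) <= L1%:E * avg_star f B)%E.

Definition T2 (L2 : R) S : Prop :=
  forall f, Lr mu r f -> forall A, balls A -> star A <> setT ->
  exists B, [/\ balls B, A `<` B
    & (SUP mu A (S (restr f (star B `\` star A)))
         <= L2%:E * avg mu r f (star B))%E].

Definition BO S : Prop :=
  [/\ is_operator S, sublinear S &
      exists L0 L1 L2 : R, [/\ T0 L0 S, T1 L1 S & T2 L2 S]].

Definition R4 (L1 : R) S : Prop :=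
  forall f, Lr mu r f -> forall B, balls B ->
  (OSC mu B (S (restr f (~` star B))) <=
   L1%:E * ereal_sup
     [set ((ln (1 + fine (mu A) / fine (mu B)))^-1)%:E * avg mu r f A
     | A in [set A | balls A /\ B `<=` A]])%E.

(* The indicator of a ball is made U-valued by a vector u; B' may depend on u.
   When U = R this amounts to u = 1, by linearity. *)
Definition R5_unif {I : Type} (T_ : I -> (X -> U) -> X -> V) : Prop :=
  forall (u : U) B (e : R), balls B -> 0 < e ->
  exists B', [/\ balls B', B `<=` B' &
    forall B'', balls B'' -> B' `<=` B'' -> forall i,
      (OSC mu B (T_ i (restr (cst u) B'')) <= e%:E)%E].

(* A uniformly restricted family of BO operators on a doubling ball-basis;
   L1 bounds all the constants of R4. *)
Definition uniformly_restricted {I : Type} (T_ : I -> (X -> U) -> X -> V)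
    (L1 : R) : Prop :=
  [/\ forall i, BO (T_ i),
      forall i, linear_operator (T_ i),
      exists L0 : R, forall i, T0 L0 (T_ i),
      0 <= L1 /\ forall i, R4 L1 (T_ i)
    & R5_unif T_].

Definition sharp_maximal (f : X -> U) (x : X) : \bar R :=
  ereal_sup [set sharp_avg mu r f B | B in [set B | balls B /\ B x]].

(* T f = sup_i |T_i f|, as an element of L^0(X, R) *)
Definition maximal_operator {I : Type} (T_ : I -> (X -> U) -> X -> V)
    (T : (X -> U) -> X -> R) : Prop :=
  forall f, Lr mu r f -> is_L0_sup mu (fun i x => `|T_ i f x|) (T f).

End operators.

(* Main.v *)
(* Every ball Q contains a set E that misses only a small proportion of Q and
   on which the oscillation of T f is at most D times the sharp maximal function
   at any point of Q: subtract from f its mean c on Q, split f - c at a ball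
   containing Q^*, apply the weak type bound T0 to the local part and the
   regularity R4 to the far part. The logarithm in R4 absorbs the logarithmic
   growth of the means of f along balls containing Q (this is where doubling
   enters), and R5 disposes of the constant c.
   The tail bound follows by a stopping time argument. Almost every point of B
   outside E lies in a ball A that meets both E and its complement in a fixed
   proportion of A. For a disjoint Vitali subfamily, balls containing the A^*
   cover these points and have total measure at most mu(B)/2, while the
   reference values of T f on B and on each of them differ by at most
   2 D M_#f. Iterating n times, |T f - m| > (2n + 6) D M_#f can only hold on a
   set of measure at most 2^-n mu(B). *)

Require Import Defs.
From HB Require Import structures.
From mathcomp Require Import all_boot all_order all_algebra.
From mathcomp Require Import all_classical all_reals all_analysis.
From mathcomp Require Import measurable_realfun ring lra.

Set Implicit Arguments.
Unset Strict Implicit.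
Unset Printing Implicit Defensive.

Import Order.TTheory GRing.Theory Num.Theory.
Import numFieldNormedType.Exports.

Local Open Scope classical_set_scope.
Local Open Scope ring_scope.

(** Several features of the setting shape the proof. A ball-basis comes with no notion of balls
    shrinking to a point, so the Lebesgue density theorem is replaced by a statement on balls that a
    set fills by more than half, deduced from B3 and a Vitali selection. [T f] is a supremum modulo
    null sets over an arbitrary index type, so the null sets of the single [T_ i] cannot be united;
    oscillation bounds reach [T f] through the minimality of an L^0 supremum. The sharp maximal
    function may vanish or be infinite, so the good set of a ball is fixed before any level [s], and
    one set serves all points of the ball. A constant need not lie in L^r on [X], so [f - c] is cut
    at a huge ball outside which [f] itself has small norm. The proportion [4 * eta * K ^+ 3] is the
    product of [K] (from [B] to a ball containing its star), [2 * eta * K] (from the bad part of a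
    stopping ball to that ball), [K] (from a stopping ball to a ball containing its star) and 2 (the
    gain per generation). *)

(** * Finite measures, null sets and disjoint families *)

Section measure_facts.
Context {R : realType} {d : measure_display} {X : measurableType d}.
Variable mu : {measure set X -> \bar R}.

Lemma measure_mono (A B : set X) :
  measurable A -> measurable B -> A `<=` B -> (mu A <= mu B)%E.
Proof. by move=> mA mB; apply: le_measure; rewrite inE. Qed.

Lemma sub_measure_fin (A B : set X) : measurable A -> measurable B ->
  (mu B < +oo)%E -> A `<=` B -> (mu A < +oo)%E.
Proof. by move=> mA mB + AB; apply: le_lt_trans; exact: measure_mono. Qed.

Lemma fineK_measure (A : set X) : (mu A < +oo)%E -> mu A = (fine (mu A))%:E.
Proof. by move=> A_fin; rewrite fineK// ge0_fin_numE. Qed.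

Lemma fine_measure_mono (A B : set X) : measurable A -> measurable B ->
  (mu B < +oo)%E -> A `<=` B -> fine (mu A) <= fine (mu B).
Proof.
move=> mA mB Bfin AB; have Afin := sub_measure_fin mA mB Bfin AB.
by rewrite -lee_fin -!fineK_measure// measure_mono.
Qed.

Lemma fine_measureDI (A B : set X) : measurable A -> measurable B ->
  (mu A < +oo)%E ->
  fine (mu A) = fine (mu (A `\` B)) + fine (mu (A `&` B)).
Proof.
move=> mA mB Afin; have [mD mI] := (measurableD mA mB, measurableI _ _ mA mB).
have Dfin := sub_measure_fin mD mA Afin (@subDsetl _ A B).
have Ifin := sub_measure_fin mI mA Afin (@subIsetl _ A B).
by apply: EFin_inj; rewrite EFinD -!fineK_measure//; exact: measureDI.
Qed.

Lemma fine_measureU (A B : set X) : measurable A -> measurable B ->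
  (mu A < +oo)%E -> (mu B < +oo)%E ->
  (mu (A `|` B) < +oo)%E /\
  fine (mu (A `|` B)) <= fine (mu A) + fine (mu B).
Proof.
move=> mA mB Afin Bfin; have mU := measurableU _ _ mA mB.
have : (mu (A `|` B) <= mu A + mu B)%E by exact: measureU2.
rewrite (fineK_measure Afin) (fineK_measure Bfin) -EFinD => h.
have Ufin : (mu (A `|` B) < +oo)%E by apply: le_lt_trans h (ltry _).
by split => //; rewrite -lee_fin -(fineK_measure Ufin).
Qed.

Lemma measure_le_mod_negligible (A N V : set X) : measurable A ->
  measurable V -> mu.-negligible N -> A `<=` N `|` V -> (mu A <= mu V)%E.
Proof.
move=> mA mV [M [mM M0 NM]] ANV.
apply: (@le_trans _ _ (mu (M `|` V))).
  by apply: measure_mono => //; [exact: measurableU|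
    move=> x /ANV[/NM|]; [left|right]].
by apply: (le_trans (measureU2 _ mM mV)); rewrite -[leRHS]add0e -M0.
Qed.

(** Reference values are compared by evaluating a function at one point that is good for both; this
    supplies the point. *)
Lemma outside_small_set (C D N : set X) : measurable C -> measurable D ->
  (mu C < +oo)%E -> (mu D < +oo)%E -> mu.-negligible N ->
  fine (mu D) < fine (mu C) -> exists x, [/\ C x, ~ D x & ~ N x].
Proof.
move=> mC mD Cfin Dfin N0 DC; apply: contrapT => h.
have CDN : C `<=` N `|` D.
  move=> x Cx; have [Dx|nD] := pselect (D x); first by right.
  by left; apply: contrapT => nN; apply: h; exists x.
have := measure_le_mod_negligible mC mD N0 CDN.
by rewrite (fineK_measure Cfin) (fineK_measure Dfin) lee_fin leNgt DC.
Qed.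

Lemma disjoint_family_countable (J : pointedType) (S : set J) (u : J -> set X)
    (F : set X) : measurable F -> (mu F < +oo)%E ->
  (forall C, S C -> [/\ measurable (u C), u C `<=` F & (0 < mu (u C))%E]) ->
  trivIset S u -> countable S.
Proof.
move=> mF Ffin Su tS.
pose Sn (n : nat) := [set C | S C /\ ((n.+1%:R^-1)%:E <= mu (u C))%E].
suff finS n : finite_set (Sn n).
  suff -> : S = \bigcup_n Sn n.
    by apply: bigcup_countable => // n _; exact: finite_set_countable.
  apply/seteqP; split=> [C SC|C [n _ []]//].
  have [mu_C uF upos] := Su _ SC.
  have ufin : mu (u C) \is a fin_num.
    by rewrite ge0_fin_numE//; apply: le_lt_trans Ffin; exact: measure_mono.
  have fpos : 0 < fine (mu (u C)) by rewrite -lte_fin fineK.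
  have [n nu] : exists n : nat, n.+1%:R^-1 < fine (mu (u C)).
    exists (Num.truncn (fine (mu (u C)))^-1).
    rewrite invf_plt ?posrE//.
    exact: truncnS_gt.
  by exists n => //; split => //; rewrite -(fineK ufin) lee_fin ltW.
(* Infinitely many members of measure at least 1/(n+1) would include [N] disjoint ones whose total
   measure exceeds that of [F]. *)
apply: contrapT => infS.
have /ppcard_leP[i] : ([set: nat] #<= Sn n)%card by exact/infiniteP.
have iS k : Sn n (i k) by exact: funS.
have [N FN] : exists N : nat, fine (mu F) * n.+1%:R < N%:R.
  by exists (Num.truncn (fine (mu F) * n.+1%:R)).+1; exact: truncnS_gt.
have mui k : measurable (u (i k)) by have [/Su[]] := iS k.
have tri : trivIset `I_N (u \o i).
  move=> a b _ _ ab; have := tS (i a) (i b) (iS a).1 (iS b).1 ab.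
  by apply: inj; rewrite inE.
have mU : measurable (\big[setU/set0]_(k < N) (u \o i) k).
  by apply: bigsetU_measurable => k _; exact: mui.
have : (mu (\big[setU/set0]_(k < N) (u \o i) k) <= mu F)%E.
  apply: measure_mono => //; rewrite -(bigcup_mkord _ (u \o i)).
  by move=> x [k _ /=]; have [/Su[_ h _] _] := iS k; exact: h.
rewrite measure_semi_additive_ord_I//; last by move=> k _; exact: mui.
have Ff : mu F \is a fin_num by rewrite ge0_fin_numE.
move=> h; have : (\sum_(k < N) (n.+1%:R^-1)%:E <= mu F)%E.
  by apply: le_trans h; apply: lee_sum => k _ /=; have [] := iS k.
rewrite sumEFin -(fineK Ff) lee_fin sumr_const card_ord -[X in X <= _]mulr_natl.
by rewrite ler_pdivrMr// leNgt FN.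
Qed.

(** Only the [u C] are disjoint. The [v C] may overlap: they are summed by countable subadditivity,
    compared term by term with the [u C], and the latter add up to at most [mu F]. *)
Lemma disjoint_family_compare (J : pointedType) (S : set J) (u v : J -> set X)
    (F : set X) (c : R) : measurable F -> (mu F < +oo)%E -> 0 <= c ->
  (forall C, S C -> [/\ measurable (u C), u C `<=` F & (0 < mu (u C))%E]) ->
  (forall C, S C -> measurable (v C) /\ (mu (v C) <= c%:E * mu (u C))%E) ->
  trivIset S u ->
  measurable (\bigcup_(C in S) v C) /\
  (mu (\bigcup_(C in S) v C) <= c%:E * mu F)%E.
Proof.
move=> mF Ffin c0 Su Sv tS.
have /countable_injP[f finj] := disjoint_family_countable mF Ffin Su tS.
(* Reindexing by [nat] through the injection [f]; an index that is not attained contributes the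
   empty set. *)
pose w (g : J -> set X) (n : nat) := \bigcup_(C in [set C | S C /\ f C = n]) g C.
have wE g C : S C -> w g (f C) = g C.
  move=> SC; apply/seteqP; split=> [x [D [SD fDC] gx]|x gx]; last by exists C.
  by have -> : C = D by apply: finj; rewrite ?inE.
have w0 g n : ~ (exists2 C, S C & f C = n) -> w g n = set0.
  by move=> h; apply/seteqP; split=> // x [C [SC fC] _]; apply: h; exists C.
have wcase g n (P : set X -> Prop) : P set0 -> (forall C, S C -> P (g C)) ->
    P (w g n).
  move=> P0 PS; have [[C SC <-]|/(w0 g) ->//] := pselect (exists2 C, S C & f C = n).
  by rewrite wE//; exact: PS.
have bw g : \bigcup_(C in S) g C = \bigcup_n w g n.
  apply/seteqP; split=> [x [C SC gx]|x [n _ [C [SC _] gx]]]; last by exists C.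
  by exists (f C) => //; exists C.
have mwu n : measurable (w u n) by apply: wcase => // C /Su[].
have mwv n : measurable (w v n) by apply: wcase => // C /Sv[].
have mV : measurable (\bigcup_n w v n) by exact: bigcupT_measurable.
rewrite bw; split => //.
apply: (le_trans (generalized_Boole_inequality mu mwv mV)).
have le_n n : (mu (w v n) <= c%:E * mu (w u n))%E.
  have [[C SC <-]|h] := pselect (exists2 C, S C & f C = n).
    by rewrite !wE//; have [] := Sv _ SC.
  by rewrite !w0// measure0 mule0.
apply: (@le_trans _ _ (\sum_(0 <= n <oo) c%:E * mu (w u n))%E).
  by apply: lee_nneseries => // n _ _; exact: le_n.
rewrite nneseriesZl//.
apply: lee_wpmul2l; first by rewrite lee_fin.
have twu : trivIset setT (w u).
  move=> a b _ _ [x [[C [SC fC] uC] [D [SD fD] uD]]].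
  rewrite -fC -fD; congr f; apply: tS => //; by exists x.
rewrite -measure_semi_bigcup//; last exact: bigcupT_measurable.
apply: measure_mono => //; first exact: bigcupT_measurable.
by rewrite -bw => x [C SC]; have [_ h _] := Su _ SC; exact: h.
Qed.

End measure_facts.

(** * Geometry of ball-bases *)

Section ball_geometry.
Context {R : realType} {d : measure_display} {X : measurableType d}.
Variables (mu : {measure set X -> \bar R}) (balls : set (set X)) (K eta : R).
Hypothesis bb : ball_basis mu balls K.
Hypothesis dbl : doubling mu balls eta.
Hypothesis K_ge1 : 1 <= K.
Hypothesis eta_gt1 : 1 < eta.
Implicit Types A B C E F Q : set X.

Local Notation star := (ball_star mu balls).
Local Notation m A := (fine (mu A)).

Let mball := B1_measurable bb.

Lemma ball_measureE B : balls B -> mu B = (m B)%:E.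
Proof. by move=> bB; rewrite fineK// ge0_fin_numE// (B1_fin bb). Qed.

Lemma ball_measure_gt0 B : balls B -> 0 < m B.
Proof. by move=> bB; rewrite -lte_fin -ball_measureE// (B1_gt0 bb). Qed.

Lemma ball_nonempty B : balls B -> B !=set0.
Proof.
move=> bB; apply/set0P/eqP => B0.
by have := B1_gt0 bb bB; rewrite B0 measure0 ltxx.
Qed.

Lemma ball_star_sub A B : balls A -> (mu A <= 2%:E * mu B)%E -> A `&` B !=set0 ->
  A `<=` star B.
Proof. by move=> bA AB AB0 x Ax; exists A. Qed.

Lemma sub_ball_star B : balls B -> B `<=` star B.
Proof.
move=> bB; apply: ball_star_sub => //; last by rewrite setIid; exact: ball_nonempty.
by rewrite ball_measureE// -EFinM lee_fin ler_peMl ?ler1n// ltW// ball_measure_gt0.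
Qed.

Lemma ball_starP B : balls B -> exists Q,
  [/\ balls Q, star B `<=` Q, B `<=` Q & m Q <= K * m B].
Proof.
move=> bB; have [Q [bQ BQ muQ]] := B4 bb bB; exists Q; split => //.
  exact: subset_trans (sub_ball_star bB) BQ.
by rewrite -lee_fin EFinM -!ball_measureE.
Qed.

Lemma ball_measure_mono A B : balls A -> balls B -> A `<=` B -> m A <= m B.
Proof.
move=> bA bB AB; rewrite -lee_fin -!ball_measureE//.
by apply: measure_mono => //; exact: mball.
Qed.

(** The factor 2 in the definition of [star] makes it absorb every ball that meets [C] and is at
    most twice as large. The bound [M] keeps the supremum of the competing measures finite. *)
Lemma vitali_family (G : set (set X)) (M : R) : G `<=` balls ->
  (forall A, G A -> m A <= M) ->
  exists S, [/\ S `<=` G, trivIset S id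
    & forall A, G A -> exists2 C, S C & A `<=` star C].
Proof.
move=> Gb GM.
(* Zorn's lemma in place of a greedy selection: in an admissible S, a ball of G
   that meets S meets a member of S at least half as large. *)
pose P (S : set (set X)) := [/\ S `<=` G, trivIset S id
  & forall A C, G A -> S C -> A `&` C !=set0 ->
    exists2 D, S D & A `&` D !=set0 /\ m A <= 2 * m D].
have [S [[SG tS PS] maxS]] : exists S, P S /\ forall S', S `<` S' -> ~ P S'.
  apply: Zorn_bigcup => H HP Htot; split.
  - by apply: bigcup_sub => S /HP[].
  - move=> C D [S HS SC] [S' HS' S'D] CD.
    have [SS'|S'S] := Htot _ _ HS HS'.
      by have [_ t _] := HP _ HS'; apply: t => //; exact: SS'.
    by have [_ t _] := HP _ HS; apply: t => //; exact: S'S.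
  - move=> A C GA [S HS SC] AC; have [_ _ /(_ A C GA SC AC)[D SD ?]] := HP _ HS.
    by exists D => //; exists S.
suff meets A : G A -> exists2 C, S C & A `&` C !=set0.
  exists S; split => // A GA; have [C SC AC] := meets _ GA.
  have [D SD [AD mAD]] := PS _ _ GA SC AC; exists D => //.
  apply: ball_star_sub => //; first exact: Gb.
  by rewrite (ball_measureE (Gb _ GA)) (ball_measureE (Gb _ (SG _ SD))) -EFinM
    lee_fin.
move=> GA; apply: contrapT => nA.
(* Among the balls of [G] that miss [S], one with more than half the supremal measure can be added
   to [S], against maximality. *)
pose H := [set A | G A /\ ~ exists2 C, S C & A `&` C !=set0].
pose mH := [set m A | A in H].
have supH : has_sup mH.
  by split; [exists (m A), A|exists M => _ [A' [GA' _] <-]; exact: GM].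
have [_ [A0 [GA0 nA0] <-] hA0] : exists2 e, mH e & sup mH - sup mH / 2 < e.
  apply: sup_adherent => //; rewrite divr_gt0//.
  apply: (@lt_le_trans _ _ (m A)); first exact/ball_measure_gt0/Gb.
  by apply: ub_le_sup; [case: supH|exists A].
have A0S : ~ S A0.
  move=> SA0; apply: nA0; exists A0 => //; rewrite setIid.
  exact/ball_nonempty/Gb.
apply: (maxS (S `|` [set A0])).
  by split=> [|/(_ A0)]; [exact: subsetUl|move=> h; apply: A0S; apply: h; right].
split.
- by move=> C [/SG//|->].
- move=> C D [SC|->] [SD|->] // CD; first exact: tS.
    by exfalso; apply: nA0; exists C => //; rewrite setIC.
  by exfalso; apply: nA0; exists D.
- move=> A' C GA' S'C A'C.
  have [[D SD A'D]|nA'] := pselect (exists2 C, S C & A' `&` C !=set0).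
    by have [D' SD' ?] := PS _ _ GA' SD A'D; exists D' => //; left.
  exists A0; first by right.
  split; first by case: S'C A'C => [SC A'C|-> //]; exfalso; apply: nA'; exists C.
  have : m A' <= sup mH by apply: ub_le_sup; [case: supH|exists A'].
  by move: hA0; lra.
Qed.

Lemma ball_star_measurable B : measurable (star B).
Proof. by apply: (ball_separable bb) => A []. Qed.

Lemma ball_star_measure B : balls B -> (mu (star B) <= (K * m B)%:E)%E.
Proof.
move=> bB; have [Q [bQ BQ _ mQ]] := ball_starP bB.
apply: (@le_trans _ _ (mu Q)); last by rewrite ball_measureE// lee_fin.
by apply: measure_mono => //; [exact: ball_star_measurable|exact: mball].
Qed.

Definition dense_balls F := [set A | balls A /\ m A < 2 * m (A `&` F)].

(** Let [F'] be the part of [F] in no dense ball. It fills at most half of any ball, so a ball used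
    by B3 to approximate [F'] within [e] has at least half of its measure in the approximation
    error. A Vitali subfamily then bounds the measure of all these balls, hence of [F'], by a
    multiple of [e]. *)
Lemma density F : measurable F -> (mu F < +oo)%E ->
  mu.-negligible (F `\` \bigcup_(A in dense_balls F) A).
Proof.
move=> mF Ffin; set F' := F `\` _.
have mF' : measurable F'.
  by apply: measurableD => //; apply: (ball_separable bb) => A [].
have F'fin : (mu F' < +oo)%E by apply: sub_measure_fin Ffin _ => // x [].
(* A dense ball misses [F']; in any other ball already [F] takes at most half. *)
have half A : balls A -> m A <= 2 * m (A `\` F').
  move=> bA; have mA := mball bA.
  have Afin := B1_fin bb bA.
  suff : 2 * m (A `&` F') <= m A by rewrite (fine_measureDI mA mF' Afin); lra.
  have [dA|ndA] := pselect (dense_balls F A).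
    rewrite (_ : A `&` F' = set0) ?measure0 ?mulr0 ?(ltW (ball_measure_gt0 bA))//.
    by apply/seteqP; split=> // x [Ax [_ /=]]; apply; exists A.
  apply: (@le_trans _ _ (2 * m (A `&` F))); last first.
    by rewrite leNgt; apply/negP => h; apply: ndA; split.
  rewrite ler_wpM2l//; apply: fine_measure_mono.
  - exact: measurableI.
  - exact: measurableI.
  - by apply: sub_measure_fin Ffin _ => //; exact: measurableI.
  - by move=> x [Ax [Fx _]]; split.
suff small e : 0 < e -> m F' <= (2 * K + 1) * e.
  apply/negligibleP => //; apply: (etrans (fineK_measure F'fin)); congr EFin.
  apply/eqP; rewrite eq_le fine_ge0// andbT; apply/ler_addgt0Pr => e e0.
  have c0 : 0 < 2 * K + 1 by move: K_ge1; lra.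
  have := small (e / (2 * K + 1)); rewrite divr_gt0// => /(_ isT).
  by rewrite mulrCA divff ?gt_eqF// mulr1 add0r.
move=> e0.
have [Fam [cFam Famb]] := B3 bb mF' e0.
set U := \bigcup_(B in Fam) B; set De := F' `+` U => De_lt.
have mU : measurable U by exact: (ball_separable bb).
have mDe : measurable De by apply: measurableU; exact: measurableD.
have Dfin : (mu De < +oo)%E by apply: lt_trans De_lt _; exact: ltry.
have AD A : Fam A -> A `\` F' `<=` De.
  by move=> FA x [Ax nF]; right; split => //; exists A.
have mAF A : Fam A -> measurable (A `\` F').
  by move=> /Famb/mball mA; exact: measurableD.
have De_e : m De < e by rewrite -lte_fin -(fineK_measure Dfin).
have [S [SF tS SU]] : exists S, [/\ S `<=` Fam, trivIset S id
    & forall A, Fam A -> exists2 C, S C & A `<=` star C].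
  apply: (@vitali_family _ (2 * m De)) => // A FA.
  apply: (le_trans (half _ (Famb _ FA))); rewrite ler_wpM2l//.
  by apply: fine_measure_mono => //; [exact: mAF|exact: AD].
have [] := @disjoint_family_compare _ _ _ mu _ S (fun C => C `\` F') star De
  (2 * K) mDe Dfin.
- by move: K_ge1; lra.
- move=> C SC; have bC := Famb _ (SF _ SC).
  split; [exact/mAF/SF|exact/AD/SF|].
  rewrite (fineK_measure (sub_measure_fin (mAF _ (SF _ SC)) mDe Dfin (AD _ (SF _ SC)))).
  by rewrite lte_fin; move: (half _ bC) (ball_measure_gt0 bC); lra.
- move=> C SC; have bC := Famb _ (SF _ SC).
  split; first exact: ball_star_measurable.
  apply: (le_trans (ball_star_measure bC)).
  rewrite (fineK_measure (sub_measure_fin (mAF _ (SF _ SC)) mDe Dfin (AD _ (SF _ SC)))).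
  rewrite -EFinM lee_fin -mulrA mulrCA ler_wpM2l// ?half//.
  by move: K_ge1; lra.
- move=> C D SC SD [x [[Cx _] [Dx _]]]; apply: tS => //; by exists x.
move=> mV; set V := \bigcup_(C in S) _ in mV *.
rewrite (fineK_measure Dfin) -EFinM => Vle.
have Vfin : (mu V < +oo)%E by apply: le_lt_trans Vle _; exact: ltry.
have F'DV : F' `<=` De `|` V.
  move=> x F'x; have [[A FA Ax]|nU] := pselect (U x).
    by right; have [C SC AsC] := SU _ FA; exists C => //; exact: AsC.
  by left; left.
have [DVfin DVle] := fine_measureU mDe mV Dfin Vfin.
have := fine_measure_mono mF' (measurableU _ _ mDe mV) DVfin F'DV.
have : m V <= 2 * K * m De by rewrite -lee_fin -(fineK_measure Vfin).
have : 2 * K * m De <= 2 * K * e by rewrite ler_wpM2l// ?ltW//; move: K_ge1; lra.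
by move: De_e DVle; rewrite mulrDl mul1r; lra.
Qed.

(** Doubling only promises a strictly larger ball, perhaps barely larger. Applied to a ball [Q]
    containing [star A] it yields real growth: a proper superset of [Q] of measure below [2 * m A]
    would lie in [star A], hence in [Q]. The second alternative is the case [star Q = setT]. *)
Lemma ball_growth A : balls A ->
  (exists A', [/\ balls A', A `<=` A', 2 * m A <= m A' & m A' <= eta * K * m A])
  \/ (balls setT /\ m setT <= K ^+ 2 * m A).
Proof.
move=> bA; have [Q [bQ AQ sAQ mQ]] := ball_starP bA.
have K0 : 0 <= K by move: K_ge1; lra.
have [QT|QT] := pselect (star Q = setT).
  right; have [Q' [bQ' QQ' _ mQ']] := ball_starP bQ.
  have Q'T : Q' = setT by apply/seteqP; split=> // x _; apply: QQ'; rewrite QT.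
  rewrite Q'T in bQ' mQ'; split => //; apply: (le_trans mQ').
  by rewrite expr2 -mulrA ler_wpM2l.
left; have [A' [bA' [QA' A'Q] mA']] := dbl bQ QT.
exists A'; split => //; first exact: subset_trans QA'.
  rewrite leNgt; apply/negP => lt; apply: A'Q; apply: subset_trans AQ.
  apply: ball_star_sub => //.
    by rewrite (ball_measureE bA') (ball_measureE bA) -EFinM lee_fin ltW.
  by have [x Ax] := ball_nonempty bA; exists x; split => //; exact/QA'/sAQ.
rewrite -lee_fin -(ball_measureE bA'); apply: (le_trans mA').
rewrite (ball_measureE bQ) -EFinM lee_fin -mulrA ler_wpM2l//.
by move: eta_gt1; lra.
Qed.

(** Of two balls that meet, the smaller lies in the star of the larger; B2 gives a ball meeting both
    [A] and [B]. *)
Lemma ball_join A B : balls A -> balls B -> exists Q,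
  [/\ balls Q, A `<=` Q & B `<=` Q].
Proof.
have join A' B' : balls A' -> balls B' -> A' `&` B' !=set0 ->
    exists Q, [/\ balls Q, A' `<=` Q & B' `<=` Q].
  wlog: A' B' / m A' <= m B' => [th|le_AB] bA bB AB.
    have [le_AB|/ltW le_BA] := leP (m A') (m B'); first exact: th.
    rewrite setIC in AB; have [Q [bQ BQ AQ]] := th _ _ le_BA bB bA AB.
    by exists Q.
  have [Q [bQ sQ BQ _]] := ball_starP bB; exists Q; split => //.
  apply: subset_trans sQ; apply: ball_star_sub => //.
  rewrite (ball_measureE bA) (ball_measureE bB) -EFinM lee_fin.
  by move: (ball_measure_gt0 bB); lra.
move=> bA bB.
have [[a Aa] [b Bb]] := (ball_nonempty bA, ball_nonempty bB).
have [C bC [Ca Cb]] := B2 bb a b.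
have [|D [bD AD CD]] := join A C bA bC; first by exists a.
have [|Q [bQ DQ BQ]] := join D B bD bB; first by exists b; split => //; exact: CD.
by exists Q; split => //; exact: subset_trans AD DQ.
Qed.

(** Both bounds on the share of [F] in [C] matter: the upper one leaves half of [C] to the
    complement of [F], where the old reference value is valid, and the lower one controls the total
    measure of the disjoint [C] by [m F]. *)
Lemma stopping_balls B F : balls B -> measurable F -> (mu F < +oo)%E ->
  4 * eta * K ^+ 2 * m F <= m B ->
  exists S : set (set X), [/\ S `<=` balls, trivIset S id,
    forall C, S C -> [/\ C `<=` star B, 2 * m (C `&` F) <= m C
                       & m C <= 2 * eta * K * m (C `&` F)]
    & mu.-negligible ((F `&` B) `\` \bigcup_(C in S) star C)].
Proof.
move=> bB mF Ffin FB.
have mF0 : 0 <= m F by rewrite fine_ge0.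
have IF A : measurable A -> m (A `&` F) <= m F.
  by move=> mA; apply: fine_measure_mono => //; exact: measurableI.
have eK : 1 <= eta * K by move: K_ge1 eta_gt1; nra.
pose G := [set A | [/\ balls A, A `&` B !=set0, 2 * m (A `&` F) <= m A
                     & m A <= 2 * eta * K * m (A `&` F)]].
have Gle A : G A -> m A <= 2 * (eta * K) * m F.
  move=> [bA _ _ h]; apply: (le_trans h); rewrite -(mulrA 2) ler_wpM2l ?IF//.
    by move: eK; lra.
  exact: mball.
have [|S [SG tS GS]] := @vitali_family G _ _ Gle; first by move=> A [].
exists S; split => //; first by move=> A /SG[].
  move=> C SC; have GC := SG _ SC; have [bC CB C1 C2] := GC; split => //.
  apply: ball_star_sub => //.
  rewrite (ball_measureE bC) (ball_measureE bB) -EFinM lee_fin.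
  have := Gle _ GC; have := ball_measure_gt0 bB.
  have : 2 * (eta * K) * m F <= 4 * eta * K ^+ 2 * m F.
    by rewrite ler_wpM2r//; move: K_ge1 eK; nra.
  by move: FB; lra.
apply: negligibleS (density mF Ffin) => x [[Fx Bx] nS]; split => // -[A dA Ax].
apply: nS; suff [A' GA' A'x] : exists2 A', G A' & A' x.
  by have [C SC sub] := GS _ GA'; exists C => //; exact: sub.
(* A ball growing a dense ball of almost maximal measure is no longer dense. *)
pose H := [set m A | A in [set A | dense_balls F A /\ A x]].
have ubH : ubound H (2 * m F).
  move=> _ [A' [[bA' dA'] _] <-]; apply: (le_trans (ltW dA')).
  by rewrite ler_wpM2l// IF//; exact: mball.
have supH : has_sup H by split; [exists (m A), A|exists (2 * m F)].
have bA : balls A by case: dA.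
have [_ [A0 [[bA0 dA0] A0x] <-] hA0] : exists2 e, H e & sup H - sup H / 2 < e.
  apply: sup_adherent => //; rewrite divr_gt0//.
  apply: (lt_le_trans (ball_measure_gt0 bA)).
  by apply: ub_le_sup; [case: supH|exists A].
have A0F := IF _ (mball bA0).
(* If [setT] were a ball of measure at most [K ^+ 2 * m A0], then
   [m B <= 2 * K ^+ 2 * m F <= m B / 2]. *)
have [[A' [bA' sA' A'1 A'2]]|[bT mT]] := ball_growth bA0; last first.
  exfalso; have := ball_measure_mono bB bT (@subsetT _ _).
  have := ball_measure_gt0 bB; have : K ^+ 2 * m A0 <= K ^+ 2 * (2 * m F).
    by rewrite ler_wpM2l ?sqr_ge0//; move: dA0 A0F; lra.
  have : 4 * K ^+ 2 * m F <= 4 * eta * K ^+ 2 * m F.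
    rewrite ler_wpM2r// ler_wpM2r ?sqr_ge0//; move: eta_gt1; lra.
  by move: mT FB; nra.
exists A'; last exact: sA'.
split => //; first by exists x; split => //; exact: sA'.
  rewrite leNgt; apply/negP => dA'.
  have : m A' <= sup H.
    by apply: ub_le_sup; [case: supH|exists A' => //; split => //; exact: sA'].
  by move: hA0 A'1; lra.
apply: (le_trans A'2); rewrite -(mulrA 2) mulrAC -mulrA.
have : m (A0 `&` F) <= m (A' `&` F).
  apply: fine_measure_mono; [exact/measurableI/mF/mball|
    exact/measurableI/mF/mball| |exact: setSI].
  by apply: sub_measure_fin Ffin _ => //; exact/measurableI/mF/mball.
by move: dA0 eK; nra.
Qed.

(** * Exponential decay by iterated stopping balls *)

Section exponential_decay.
Variables (g : X -> R) (w : X -> \bar R).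
Hypothesis mg : measurable_fun setT g.
Hypothesis mw : measurable_fun setT w.
Hypothesis w_ge0 : forall x, (0 <= w x)%E.

(* [a] is a reference value of [g] on most of [Q]. The bound [w] is evaluated at
   an arbitrary point [y] of [Q] because it stands for the infimum of [w] on [Q].
   The proportion 1 / (4 eta K^3) makes the stopping balls shrink by 1/2. *)
Definition centered Q E (a : R) := [/\ measurable E, E `<=` Q,
  4 * eta * K ^+ 3 * m (Q `\` E) <= m Q &
  exists2 N, mu.-negligible N &
    forall x y, (E `\` N) x -> Q y -> (`|g x - a|%:E <= w y)%E].

Definition deviation (s : R) B (a : R) :=
  [set x | B x /\ (s%:E * w x < `|g x - a|%:E)%E].

Lemma deviation_measurable s B a : measurable B -> measurable (deviation s B a).
Proof.
move=> mB; rewrite (_ : deviation s B a =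
    B `&` ((fun x => (s%:E * w x < `|g x - a|%:E)%E) @^-1` [set true])); last first.
  by apply/seteqP; split=> x [].
apply: measurableI => //; rewrite -[X in measurable X]setTI.
apply: (@measurable_fun_lte _ _ _ setT (fun x => s%:E * w x)%E
  (fun x => (`|g x - a|)%:E)) => //.
  exact: measurable_funeM.
apply/measurable_EFinP; apply: measurableT_comp => //.
exact: measurable_funB.
Qed.

(** The two exceptional sets do not fill [C], so some [z] in [C] is good for both; [g z] is within
    [w y] of [a] and of [a']. *)
Lemma centered_meet Q E a Q' E' a' C y : balls C -> balls Q -> balls Q' ->
  centered Q E a -> centered Q' E' a' ->
  C `<=` Q -> C `<=` Q' ->
  m (C `\` E) + m (Q' `\` E') < m C ->
  Q y -> Q' y -> (`|a' - a|%:E <= w y + w y)%E.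
Proof.
move=> bC bQ bQ' [mE EQ _ [N N0 EN]] [mE' EQ' _ [N' N'0 EN']] CQ CQ' lt Qy Q'y.
have [mC mQ'] := (mball bC, mball bQ').
have mD := measurableD mC mE; have mD' := measurableD mQ' mE'.
have Dfin : (mu (C `\` E) < +oo)%E.
  by apply: sub_measure_fin (B1_fin bb bC) _ => // x [].
have D'fin : (mu (Q' `\` E') < +oo)%E.
  by apply: sub_measure_fin (B1_fin bb bQ') _ => // x [].
have [Ufin Ule] := fine_measureU mD mD' Dfin D'fin.
have [|z [Cz nD nN]] := outside_small_set mC (measurableU _ _ mD mD')
    (B1_fin bb bC) Ufin (negligibleU N0 N'0); first exact: le_lt_trans lt.
have Ez : E z by apply: contrapT => nE; apply: nD; left.
have E'z : E' z by apply: contrapT => nE; apply: nD; right; split => //; exact: CQ'.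
have h1 : (`|g z - a|%:E <= w y)%E.
  by apply: EN => //; split => // Nz; apply: nN; left.
have h2 : (`|g z - a'|%:E <= w y)%E.
  by apply: EN' => //; split => // Nz; apply: nN; right.
apply: le_trans (leeD h2 h1); rewrite -EFinD lee_fin (distrC (g z)).
exact: ler_distD.
Qed.

(** Each generation costs [2 w], the distance between successive reference values, and halves the
    measure. The pair [E], [a] lives on the larger [Q] because stopping balls may leave [B], but
    stay in [star B]. *)
Lemma centered_decay (n : nat) B Q E a :
  (forall Q, balls Q -> exists E a, centered Q E a) ->
  balls B -> balls Q -> star B `<=` Q -> m Q <= K * m B ->
  centered Q E a ->
  (mu (deviation (2 * n%:R + 1) B a) <= (2^-1 ^+ n * m B)%:E)%E.
Proof.
move=> cen; elim: n B Q E a => [|n IH] B Q E a bB bQ sBQ mQB cQ.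
  rewrite expr0 mul1r -ball_measureE//; apply: measure_mono.
  - exact/deviation_measurable/mball.
  - exact: mball.
  - by move=> x [].
have [mE EQ FQ [N N0 EN]] := cQ.
pose F := Q `\` E.
have mF : measurable F by apply: measurableD => //; exact: mball.
have Ffin : (mu F < +oo)%E.
  by apply: sub_measure_fin (B1_fin bb bQ) _ => //; [exact: mball|move=> x []].
have K0 : 0 < K by move: K_ge1; lra.
have FB : 4 * eta * K ^+ 2 * m F <= m B.
  rewrite -(ler_pM2l K0); apply: le_trans mQB; apply: le_trans FQ.
  by rewrite [X in _ <= X](_ : _ = K * (4 * eta * K ^+ 2 * m F))//; ring.
have [S [Sb tS SP SN]] := stopping_balls bB mF Ffin FB.
(* The next generation runs on [Q1], which contains [star C] and so keeps the covering; its
   reference value comes from [Q2], which contains [star Q1]. Outside [S] the pair is a dummy value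
   for [choice]. *)
have next C : exists p : set X * R, S C -> [/\ balls p.1, star C `<=` p.1,
    m p.1 <= K * m C,
    (mu (deviation (2 * n%:R + 1) p.1 p.2) <= (2^-1 ^+ n * m p.1)%:E)%E &
    forall x, B x -> p.1 x -> (`|p.2 - a|%:E <= w x + w x)%E].
  have [SC|] := pselect (S C); last by exists (set0, 0).
  have bC := Sb _ SC; have [Q1 [bQ1 CQ1 CQ1' mQ1]] := ball_starP bC.
  have [Q2 [bQ2 Q12 Q12' mQ2]] := ball_starP bQ1.
  have [E2 [a2 c2]] := cen _ bQ2; exists (Q1, a2) => _ /=; split => //.
    exact: (IH _ _ _ _ bQ1 bQ2 Q12 mQ2 c2).
  have [CB C1 C2] := SP _ SC.
  move=> x Bx Q1x; apply: (centered_meet bC bQ bQ2 cQ c2).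
  - exact: subset_trans CB sBQ.
  - exact: subset_trans CQ1' Q12'.
  (* The two bad parts take at most 1/2 and 1/4 of [C]: the first by the stopping rule, the second
     since [m Q2 <= K ^+ 2 * m C]. *)
  - rewrite (_ : C `\` E = C `&` F).
      have [_ _ + _] := c2; have := ball_measure_gt0 bC.
      have h : m Q2 <= K ^+ 2 * m C.
        by apply: (le_trans mQ2); rewrite expr2 -mulrA ler_pM2l.
      move=> C0 h2; suff : 4 * m (Q2 `\` E2) <= m C by move: C1 C0; lra.
      have D0 : 0 <= m (Q2 `\` E2) by rewrite fine_ge0.
      rewrite -(@ler_pM2l _ (K ^+ 2)) ?exprn_gt0//; apply: le_trans h.
      apply: le_trans h2; rewrite mulrA ler_wpM2r//.
      rewrite (_ : 4 * eta * K ^+ 3 = K ^+ 2 * 4 * (eta * K)); last by ring.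
      rewrite ler_peMr//; first by rewrite mulr_ge0// exprn_ge0// ltW.
      by apply: mulr_ege1 => //; exact: ltW.
    apply/seteqP; split=> [z [Cz nE]|z [Cz []]//].
    by split => //; split => //; exact/sBQ/CB.
  - exact/sBQ/sub_ball_star.
  - exact: Q12'.
have [p pP] := choice next.
have mCF C : S C -> measurable (C `&` F) by move=> /Sb/mball mC; exact: measurableI.
have CFfin C : S C -> (mu (C `&` F) < +oo)%E.
  by move=> SC; apply: sub_measure_fin Ffin _ => //; exact: mCF.
(* The factor is [2^-1 ^+ n] from the induction times [2 * eta * K ^+ 2], from
   [m (p C).1 <= K * m C] and the lower share of [F] in [C]. By [FB] it gains 1/2 over [m B]. *)
have [] := @disjoint_family_compare _ _ _ mu _ S (fun C => C `&` F)
    (fun C => deviation (2 * n%:R + 1) (p C).1 (p C).2) F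
    (2^-1 ^+ n * (2 * eta * K ^+ 2)) mF Ffin.
- by rewrite !mulr_ge0// ?exprn_ge0//; move: eta_gt1 K0; lra.
- move=> C SC; split => //; first exact: mCF.
  rewrite (fineK_measure (CFfin _ SC)) lte_fin.
  have [_ _ C2] := SP _ SC; have := ball_measure_gt0 (Sb _ SC).
  have : 0 < eta * K by rewrite mulr_gt0//; move: eta_gt1; lra.
  have : 0 <= m (C `&` F) by rewrite fine_ge0.
  by move: C2; nra.
- move=> C SC; have [b1 _ mp dp _] := pP _ SC; split.
    exact/deviation_measurable/mball.
  apply: (le_trans dp); rewrite (fineK_measure (CFfin _ SC)) -EFinM lee_fin.
  rewrite -(mulrA (2^-1 ^+ n)) ler_wpM2l ?exprn_ge0//; apply: (le_trans mp).
  have [_ _ C2] := SP _ SC.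
  rewrite [leRHS](_ : _ = K * (2 * eta * K * m (C `&` F))); last by ring.
  by rewrite ler_pM2l.
- by move=> C D SC SD [x [[Cx _] [Dx _]]]; apply: tS => //; exists x.
move=> mV Vle.
have BN : deviation (2 * n.+1%:R + 1) B a `<=`
    (N `|` (F `&` B) `\` \bigcup_(C in S) star C) `|`
    \bigcup_(C in S) deviation (2 * n%:R + 1) (p C).1 (p C).2.
  move=> x [Bx dx].
  (* Where [w x] is [+oo], so is its positive multiple, and the strict inequality in [deviation]
     fails. *)
  have wfin : w x \is a fin_num.
    rewrite ge0_fin_numE ?w_ge0//.
    move: dx; case: (w x) (w_ge0 x) => [r _ _|_|//]; first exact: ltry.
    by rewrite gt0_muley ?lte_fin// ltr_wpDl// mulr_ge0.
  have [v wE] : exists v, w x = v%:E by exists (fine (w x)); rewrite fineK.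
  have v0 : 0 <= v by rewrite -lee_fin -wE.
  have {}dx : (2 * n.+1%:R + 1) * v < `|g x - a|.
    by rewrite -lte_fin EFinM -wE.
  have n0 : 0 <= n%:R :> R by [].
  have [Nx|nNx] := pselect (N x); first by left; left.
  have Qx : Q x by exact/sBQ/sub_ball_star.
  have [Ex|nEx] := pselect (E x).
    have := EN x x (conj Ex nNx) Qx.
    by rewrite wE lee_fin => h; exfalso; move: dx h v0 n0; rewrite -natr1; nra.
  have [[C SC Cx]|nC] := pselect ((\bigcup_(C in S) star C) x); last first.
    by left; right.
  right; exists C => //; have [_ Cp _ _ /(_ x Bx (Cp _ Cx))] := pP _ SC.
  rewrite wE -EFinD lee_fin => h; split; first exact: Cp.
  rewrite wE -EFinM lte_fin.
  have : `|g x - a| <= `|g x - (p C).2| + `|(p C).2 - a| by exact: ler_distD.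
  by move: dx h v0 n0; rewrite -natr1; nra.
apply: (@le_trans _ _ (mu (\bigcup_(C in S) deviation (2 * n%:R + 1) (p C).1 (p C).2))).
  apply: measure_le_mod_negligible BN => //.
    exact/deviation_measurable/mball.
  exact: negligibleU.
apply: (le_trans Vle); rewrite (fineK_measure Ffin) -EFinM lee_fin.
rewrite (exprSr _ n) -(mulrA _ _ (m F)) -(mulrA _ _ (m B)) ler_wpM2l ?exprn_ge0// ler_pdivlMl//.
by apply: le_trans FB; rewrite [leLHS](_ : _ = 4 * eta * K ^+ 2 * m F)//; ring.
Qed.

(** The bad part of [Q] has at most a quarter of the measure of [B]. So [E] meets the set [E'] of
    the median, which fills more than half of [B], and [E] intersected with [B] competes in
    [OSC_beta], which is thus at most [2 w]. The constant is 5 = 2 * 2 + 1: twice the oscillation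
    bound, plus one step to [a]. *)
Lemma median_center B Q E a m0 y : balls B -> balls Q -> star B `<=` Q ->
  m Q <= K * m B -> centered Q E a -> is_median mu (g : X -> R^o) B m0 -> B y ->
  (`|m0 - a|%:E <= 5%:E * w y)%E.
Proof.
move=> bB bQ sBQ mQ [mE EQ mQE [N N0 EN]] [x0 [E' [mE' E'B E'gt E'osc] E'x0] <-] By.
have [mB mQ'] := (mball bB, mball bQ); have B0 := ball_measure_gt0 bB.
have BQ : B `<=` Q by exact: subset_trans (sub_ball_star bB) sBQ.
have Qy := BQ _ By; have mD := measurableD mQ' mE.
have Dfin : (mu (Q `\` E) < +oo)%E.
  by apply: sub_measure_fin (B1_fin bb bQ) _ => // x [].
have E'fin := sub_measure_fin mE' mB (B1_fin bb bB) E'B.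
have K0 : 0 < K by move: K_ge1; lra.
have QE4 : 4 * m (Q `\` E) <= m B.
  have D0 : 0 <= m (Q `\` E) by rewrite fine_ge0.
  rewrite -(ler_pM2l K0); apply: le_trans mQ; apply: le_trans mQE.
  rewrite mulrA ler_wpM2r//.
  rewrite (_ : 4 * eta * K ^+ 3 = K * 4 * (eta * K ^+ 2)); last by ring.
  rewrite ler_peMr//; first by rewrite mulr_ge0// ltW.
  by apply: mulr_ege1; [exact: ltW|exact: exprn_ege1].
have {}E'gt : m B < 2 * m E'.
  move: E'gt; rewrite (ball_measureE bB) (fineK_measure E'fin) -EFinM lte_fin.
  by rewrite ltr_pdivrMl.
have osc : (OSC_beta mu 2^-1 B (g : X -> R^o) <= w y + w y)%E.
  apply: (@le_trans _ _ (OSC mu (E `&` B) (g : X -> R^o))).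
    apply: ereal_inf_lbound; exists (E `&` B) => //.
    have mEB := measurableI _ _ mE mB; split => //.
    have EBfin : (mu (E `&` B) < +oo)%E.
      by apply: sub_measure_fin (B1_fin bb bB) _ => // x [].
    rewrite (fineK_measure EBfin) (ball_measureE bB) -EFinM lte_fin.
    have := fine_measureDI mB mE (B1_fin bb bB); rewrite setIC.
    have : m (B `\` E) <= m (Q `\` E).
      by apply: fine_measure_mono => //; [exact: measurableD|exact: setSD].
    by move: QE4 B0; lra.
  apply: ereal_inf_lbound; exists N => // x x' [[Ex _] nN] [[Ex' _] nN'].
  have h1 : (`|g x - a|%:E <= w y)%E by apply: EN.
  have h2 : (`|g x' - a|%:E <= w y)%E by apply: EN.
  apply: le_trans (leeD h1 h2); rewrite -EFinD lee_fin (distrC (g x')).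
  exact: ler_distD.
have [|z [E'z nD nN]] := outside_small_set mE' mD E'fin Dfin N0.
  by move: QE4 E'gt B0; lra.
have Ez : E z by apply: contrapT => nE; apply: nD; split => //; exact/BQ/E'B.
have h1 : (`|g z - a|%:E <= w y)%E by apply: EN.
have h2 := E'osc _ _ E'x0 E'z.
apply: (@le_trans _ _ (`|g x0 - g z| + `|g z - a|)%:E).
  by rewrite lee_fin; exact: ler_distD.
rewrite EFinD; apply: (le_trans (leeD h2 h1)).
apply: (@le_trans _ _ (2%:E * (w y + w y) + w y)%E).
  by rewrite leeD2r// lee_wpmul2l// lee_fin.
move: (w_ge0 y); case: (w y) => [v v0| _|//].
  by do ![rewrite -EFinD | rewrite -EFinM]; rewrite lee_fin; lra.
by rewrite [leRHS]gt0_muley ?lte_fin ?leey.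
Qed.

(** 6 = 1 + 5: replacing [a] by the median costs [5 w]. *)
Lemma median_deviation (n : nat) B m0 :
  (forall Q, balls Q -> exists E a, centered Q E a) ->
  balls B -> is_median mu (g : X -> R^o) B m0 ->
  (mu (deviation (2 * n%:R + 6) B m0) <= (2^-1 ^+ n * m B)%:E)%E.
Proof.
move=> cen bB med; have [Q [bQ sBQ BQ mQ]] := ball_starP bB.
have [E [a c]] := cen _ bQ.
apply: le_trans (centered_decay n cen bB bQ sBQ mQ c).
apply: measure_mono; do ?exact/deviation_measurable/mball.
move=> x [Bx dx]; split => //.
have := median_center bB bQ sBQ mQ c med Bx.
move: dx (w_ge0 x); case: (w x) => [v| |//].
  rewrite -!EFinM !lte_fin !lee_fin => dx v0 h.
  have : `|g x - m0| <= `|g x - a| + `|m0 - a|.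
    by rewrite (distrC m0); exact: ler_distD.
  by move: dx; lra.
by rewrite gt0_muley// lte_fin ltr_wpDl// mulr_ge0.
Qed.

End exponential_decay.
End ball_geometry.

(** * Strongly measurable functions and Bochner means *)

Section strong_measurability.
Context {R : realType} {d : measure_display} {X : measurableType d}.

(** [A] is arbitrary: no sigma-algebra is put on [V], and the preimage is a finite union of
    fibres. *)
Lemma vsimple_measurable (V : normedModType R) (s : X -> V) (A : set V) :
  vsimple s -> measurable (s @^-1` A).
Proof.
move=> [fs ms].
rewrite (_ : s @^-1` A = \bigcup_(v in range s `&` A) s @^-1` [set v]).
  apply: fin_bigcup_measurable => //.
  by apply: sub_finite_set fs => v [].
apply/seteqP; split=> [x Ax|x [v [_ Av] /= sv]]; last by rewrite /preimage/= sv.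
by exists (s x) => //; split => //; exists x.
Qed.

Lemma vsimple_comp2 (V W Z : normedModType R) (s : X -> V) (t : X -> W)
    (h : V -> W -> Z) :
  vsimple s -> vsimple t -> vsimple (fun x => h (s x) (t x)).
Proof.
move=> ss ts; have [[fs _] [ft _]] := (ss, ts); split.
  apply: (@sub_finite_set _ _ [set h v w | v in range s & w in range t]).
    by move=> _ [x _ <-]; exists (s x); [exists x|exists (t x); [exists x|]].
  exact: finite_image2.
move=> z; rewrite (_ : _ @^-1` _ = \bigcup_(v in range s)
    (s @^-1` [set v] `&` t @^-1` [set w | h v w = z])).
  apply: fin_bigcup_measurable => // v _.
  by apply: measurableI; exact: vsimple_measurable.
by apply/seteqP; split=> [x hx|x [v _ [/= ->]]//]; exists (s x).
Qed.

Lemma smeasurable_comp2 (V W Z : normedModType R) (f : X -> V) (g : X -> W)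
    (h : V -> W -> Z) :
  (forall (s : nat -> V) (t : nat -> W) a b, s @ \oo --> a -> t @ \oo --> b ->
    (fun n => h (s n) (t n)) @ \oo --> h a b) ->
  smeasurable f -> smeasurable g -> smeasurable (fun x => h (f x) (g x)).
Proof.
move=> hc [s [ss sf]] [t [ts tg]]; exists (fun n x => h (s n x) (t n x)).
split=> [n|x]; first exact: vsimple_comp2.
exact: hc.
Qed.

Lemma vsimple_indic (D : set X) : measurable D -> vsimple (\1_D : X -> R^o).
Proof.
move=> mD; split.
  apply: (@sub_finite_set _ _ [set 0; 1]); last by [].
  by move=> _ [x _ <-]; rewrite indicE; case: (x \in D); [right|left].
move=> v.
rewrite (_ : _ @^-1` _ = (D `&` [set _ | 1 = v]) `|` (~` D `&` [set _ | 0 = v])).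
  have mP (P : Prop) : measurable [set _ : X | P].
    have [p|np] := pselect P.
      by rewrite (_ : [set _ | _] = setT)//; apply/seteqP; split.
    by rewrite (_ : [set _ | _] = set0)//; apply/seteqP; split.
  by apply: measurableU; apply: measurableI => //; exact: measurableC.
apply/seteqP; split=> x /=; rewrite indicE.
  by have [xD <-|xD <-] := boolP (x \in D); [left|right]; split => //;
    [exact: set_mem|move/negP: xD; rewrite inE].
by case=> -[Dx <-]; [rewrite mem_set|rewrite memNset].
Qed.

Lemma vsimple_cst (V : normedModType R) (v : V) : vsimple (cst v : X -> V).
Proof.
split; first by apply: (@sub_finite_set _ _ [set v]) => // _ [x _ <-].
move=> w; have [->|wv] := eqVneq v w.
  by rewrite (_ : _ @^-1` _ = setT)//; apply/seteqP; split.
rewrite (_ : _ @^-1` _ = set0)//; apply/seteqP; split=> // x /= vw.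
by move: wv; rewrite vw eqxx.
Qed.

Lemma smeasurable_simple (V : normedModType R) (f : X -> V) :
  vsimple f -> smeasurable f.
Proof. by move=> sf; exists (fun=> f); split => // x; exact: cvg_cst. Qed.

Variable V : normedModType R.
Implicit Types (f g : X -> V) (D : set X).

Lemma smeasurableB f g : smeasurable f -> smeasurable g ->
  smeasurable (fun x => f x - g x).
Proof.
apply: (@smeasurable_comp2 _ _ _ f g (fun a b => a - b)) => s t a b sa tb.
exact: cvgB.
Qed.

Lemma smeasurable_restr f D : measurable D -> smeasurable f ->
  smeasurable (restr f D).
Proof.
move=> mD mf; have m1 := smeasurable_simple (vsimple_indic mD).
apply: (@smeasurable_comp2 _ _ _ _ _ (fun (a : R^o) v => a *: v) _ m1 mf).
by move=> s t a b sa tb; apply: cvgZ.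
Qed.

Lemma smeasurable_norm f : smeasurable f ->
  measurable_fun setT (fun x => `|f x|).
Proof.
move=> [s [ss sf]].
apply: (@measurable_fun_cvg _ _ _ _ (fun n x => `|s n x|)) => [n|x _].
  move=> _ Y _; rewrite setTI.
  rewrite (_ : _ @^-1` Y = s n @^-1` [set v | Y `|v|])//.
  exact: vsimple_measurable.
by apply: cvg_norm; exact: sf.
Qed.

Lemma restrE f D x : D x -> restr f D x = f x.
Proof. by move=> Dx; rewrite /restr indicE mem_set// scale1r. Qed.

Lemma restrNE f D x : ~ D x -> restr f D x = 0.
Proof. by move=> Dx; rewrite /restr indicE memNset// scale0r. Qed.

Lemma norm_restr_le f D x : `|restr f D x| <= `|f x|.
Proof.
by have [Dx|nD] := pselect (D x); [rewrite restrE|rewrite restrNE// normr0].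
Qed.

End strong_measurability.

(** * Averages with exponent r *)

Section power_averages.
Context {R : realType} {d : measure_display} {X : measurableType d}.
Variables (mu : {measure set X -> \bar R}) (r : R).
Hypothesis r_ge1 : 1 <= r.
Context {V : normedModType R}.
Implicit Types (f g h : X -> V) (A D : set X).

Local Notation m A := (fine (mu A)).

Let r_gt0 : 0 < r. Proof. exact: lt_le_trans ltr01 r_ge1. Qed.

Lemma measurable_norm_powR f A : smeasurable f ->
  measurable_fun A (fun x => (`|f x| `^ r)%:E).
Proof.
move=> /smeasurable_norm mf; apply/measurable_EFinP.
apply: (@measurable_funS _ _ _ _ setT) => //.
by apply: (measurableT_comp (measurable_powR r)).
Qed.

Lemma powR_le (a b : R) : 0 <= a -> a <= b -> a `^ r <= b `^ r.
Proof.
move=> a0 ab; apply: ge0_ler_powR => //; first exact: ltW.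
by rewrite nnegrE (le_trans a0).
Qed.

Lemma powR_addl (a b : R) : 0 <= a -> 0 <= b ->
  (a + b) `^ r <= 2 `^ r * (a `^ r + b `^ r).
Proof.
move=> a0 b0; have [ab|/ltW ba] := leP a b.
  apply: (@le_trans _ _ ((2 * b) `^ r)); first by apply: powR_le; lra.
  by rewrite powRM// ler_wpM2l ?powR_ge0// lerDr powR_ge0.
apply: (@le_trans _ _ ((2 * a) `^ r)); first by apply: powR_le; lra.
by rewrite powRM// ler_wpM2l ?powR_ge0// lerDl powR_ge0.
Qed.

Lemma powR_addr (a b : R) : 0 <= a -> 0 <= b ->
  a `^ r + b `^ r <= (2 * (a + b)) `^ r.
Proof.
move=> a0 b0; have ab0 : 0 <= a + b by lra.
rewrite powRM//.
have a1 : a `^ r <= (a + b) `^ r by apply: powR_le; lra.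
have b1 : b `^ r <= (a + b) `^ r by apply: powR_le; lra.
have : 2 * (a + b) `^ r <= 2 `^ r * (a + b) `^ r.
  by rewrite ler_wpM2r ?powR_ge0// le1r_powR// ler1n.
by move: a1 b1; lra.
Qed.

Lemma integral_pow_le f g A : measurable A -> smeasurable f -> smeasurable g ->
  (forall x, A x -> `|f x| <= `|g x|) ->
  (\int[mu]_(x in A) (`|f x| `^ r)%:E <= \int[mu]_(x in A) (`|g x| `^ r)%:E)%E.
Proof.
move=> mA mf mg fg; apply: ge0_le_integral => //; try exact: measurable_norm_powR.
by move=> x Ax; rewrite lee_fin powR_le// fg.
Qed.

Lemma integral_pow_add f g A (k : R) : measurable A ->
  smeasurable f -> smeasurable g -> 0 <= k ->
  (forall x, A x -> `|f x| <= `|g x| + k) ->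
  (\int[mu]_(x in A) (`|f x| `^ r)%:E <=
   (2 `^ r)%:E * (\int[mu]_(x in A) (`|g x| `^ r)%:E + (k `^ r)%:E * mu A))%E.
Proof.
move=> mA mf mg k0 fg.
have mpg := measurable_norm_powR (A := A) mg.
rewrite -(integral_cst mu mA) -ge0_integralD//; last first.
  by move=> x _; rewrite lee_fin powR_ge0.
rewrite -ge0_integralZl//; last 2 first.
- exact: emeasurable_funD.
- by move=> x _; rewrite -EFinD lee_fin addr_ge0 ?powR_ge0.
apply: ge0_le_integral => //.
- exact: measurable_norm_powR.
- by apply: measurable_funeM; exact: emeasurable_funD.
move=> x Ax; rewrite -EFinD -EFinM lee_fin.
apply: le_trans (powR_addl _ k0) => //.
by apply: powR_le => //; exact: fg.
Qed.

(** Removes the root and the normalisation once and for all, including the case of an infinite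
    integral. *)
Lemma avg_leP f A (s : R) : measurable A -> (0 < mu A)%E -> (mu A < +oo)%E ->
  0 <= s -> (avg mu r f A <= s%:E)%E =
    (\int[mu]_(x in A) (`|f x| `^ r)%:E <= (s `^ r * m A)%:E)%E.
Proof.
move=> mA A0 Afin s0.
have mA0 : 0 < m A by rewrite -lte_fin -(fineK_measure Afin).
rewrite /avg; set J := (\int[mu]_(x in A) _)%E.
have J0 : (0 <= J)%E by apply: integral_ge0 => x _; rewrite lee_fin powR_ge0.
have rV0 : 0 < r^-1 by rewrite invr_gt0.
case: J J0 => [J J0| _|//]; last first.
  rewrite gt0_muley ?lte_fin ?invr_gt0//.
  by rewrite poweRyr ?gt_eqF.
rewrite lee_fin in J0; rewrite -EFinM poweR_EFin !lee_fin.
have JA0 : 0 <= (m A)^-1 * J by rewrite mulr_ge0// invr_ge0 ltW.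
rewrite -ler_pdivrMr// mulrC; apply/idP/idP => [h|h].
  have := powR_le (powR_ge0 _ _) h.
  by rewrite -powRrM mulVf ?gt_eqF// powRr1// mulrC.
have := ge0_ler_powR (ltW rV0).
move=> /(_ (J / m A) (s `^ r)); rewrite !nnegrE powR_ge0 => h2.
rewrite mulrC in JA0; have := h2 JA0 isT h.
by rewrite -powRrM mulfV ?gt_eqF// powRr1// mulrC.
Qed.

Lemma avg_add f g A (s k : R) : measurable A -> (0 < mu A)%E ->
  (mu A < +oo)%E -> smeasurable f -> smeasurable g -> 0 <= s -> 0 <= k ->
  (forall x, A x -> `|f x| <= `|g x| + k) ->
  (avg mu r g A <= s%:E)%E -> (avg mu r f A <= (4 * (s + k))%:E)%E.
Proof.
move=> mA A0 Afin mf mg s0 k0 fg; rewrite !avg_leP//; last first.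
  by rewrite mulr_ge0// addr_ge0.
move=> h; apply: (le_trans (integral_pow_add mA mf mg k0 fg)).
apply: (@le_trans _ _ ((2 `^ r)%:E *
    ((s `^ r * m A)%:E + (k `^ r)%:E * mu A))%E).
  by rewrite lee_wpmul2l ?lee_fin ?powR_ge0// leeD2r.
have a0 : 0 <= m A by rewrite fine_ge0.
move: (fineK_measure Afin) a0; set a := m A => -> a0.
rewrite -(EFinM (k `^ r)) -EFinD -EFinM lee_fin -mulrDl mulrA ler_wpM2r//.
rewrite (_ : 4 * (s + k) = 2 * (2 * (s + k))); last by ring.
rewrite powRM ?mulr_ge0 ?addr_ge0// ler_wpM2l ?powR_ge0//.
exact: powR_addr.
Qed.

(** Jensen's inequality up to the factor 2, from a pointwise bound. *)
Lemma avg_integral_norm f A (s : R) : measurable A -> (0 < mu A)%E ->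
  (mu A < +oo)%E -> smeasurable f -> 0 < s -> (avg mu r f A <= s%:E)%E ->
  (\int[mu]_(x in A) `|f x|%:E <= (2 * s * m A)%:E)%E.
Proof.
move=> mA A0 Afin mf s0; rewrite avg_leP ?(ltW s0)// => h.
have mpf := measurable_norm_powR (A := A) mf.
have sr0 : 0 < s `^ r by rewrite powR_gt0.
have c0 : 0 <= s / s `^ r by rewrite divr_ge0 ?ltW.
have mnf : measurable_fun A (fun x => `|f x|%:E).
  apply/measurable_EFinP; apply: (@measurable_funS _ _ _ _ setT) => //.
  exact: smeasurable_norm.
(* |f| <= s + s (|f| / s)^r *)
apply: (@le_trans _ _ (\int[mu]_(x in A)
    ((cst s%:E) x + (s / s `^ r)%:E * (`|f x| `^ r)%:E))%E).
  apply: ge0_le_integral => //.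
    apply: emeasurable_funD => //; exact: measurable_funeM.
  move=> x _; rewrite -EFinM -EFinD lee_fin.
  have fr0 : 0 <= `|f x| `^ r by rewrite powR_ge0.
  have [fs|/ltW sf] := leP `|f x| s.
    by rewrite (le_trans fs)// lerDl mulr_ge0.
  apply: (@le_trans _ _ (s / s `^ r * `|f x| `^ r)); last by rewrite lerDr ltW.
  have : `|f x| / s <= (`|f x| / s) `^ r.
    by apply: le1r_powR => //; rewrite ler_pdivlMr// mul1r.
  have sV : s^-1 `^ r = (s `^ r)^-1.
    by rewrite -(powR_inv1 (ltW s0)) powRAC powR_inv1 ?powR_ge0.
  rewrite powRM ?invr_ge0 ?(ltW s0)// sV ler_pdivrMr// => h2.
  apply: (le_trans h2).
  by rewrite le_eqVlt; apply/orP; left; apply/eqP; ring.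
rewrite ge0_integralD//; last 3 first.
- by move=> x _; rewrite lee_fin ltW.
- by move=> x _; rewrite -EFinM lee_fin mulr_ge0// powR_ge0.
- exact: measurable_funeM.
rewrite integral_cst// ge0_integralZl//.
apply: (@le_trans _ _ (s%:E * mu A + (s / s `^ r)%:E * (s `^ r * m A)%:E)%E).
  by rewrite leeD2l// lee_wpmul2l// lee_fin.
move: (fineK_measure Afin); set a := m A => ->.
rewrite -(EFinM s) -(EFinM (s / s `^ r)) -EFinD lee_fin.
by rewrite le_eqVlt; apply/orP; left; apply/eqP; field; rewrite gt_eqF.
Qed.

End power_averages.

(** * Bochner integrals of simple functions and their limits *)

Section bochner.
Context {R : realType} {d : measure_display} {X : measurableType d}.
Variables (mu : {measure set X -> \bar R}).
Implicit Types (A D : set X).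

Local Notation m A := (fine (mu A)).

Lemma vsimple_enum (V : normedModType R) (s : X -> V) : vsimple s ->
  exists rs : seq V, [/\ uniq rs, forall x, s x \in rs &
    forall D, simple_integral mu D s =
      \sum_(v <- rs) m (D `&` s @^-1` [set v]) *: v].
Proof.
move=> [fs _]; exists (finmap.enum_fset (fset_set (range s))); split.
- exact: finmap.fset_uniq.
- by move=> x; rewrite in_fset_set// inE; exists x.
- by move=> D; rewrite /simple_integral fsbig_finite.
Qed.

Lemma fibers_cover (V : choiceType) (s : X -> V) (rs : seq V) D :
  (forall x, s x \in rs) -> D = \big[setU/set0]_(v <- rs) (D `&` s @^-1` [set v]).
Proof.
move=> srs; rewrite -bigcup_seq; apply/seteqP; split=> [x Dx|x [v _ []]//].
by exists (s x) => //=; exact: srs.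
Qed.

Lemma fibers_trivIset (V : Type) (s : X -> V) D (S : set V) :
  trivIset S (fun v => D `&` s @^-1` [set v]).
Proof. by move=> v w _ _ [x [[_ <-] [_ <-]]]. Qed.

Lemma fine_measure_fibers (V : normedModType R) (s : X -> V) (rs : seq V) D :
  vsimple s -> uniq rs -> (forall x, s x \in rs) -> measurable D ->
  (mu D < +oo)%E -> m D = \sum_(v <- rs) m (D `&` s @^-1` [set v]).
Proof.
move=> ss urs srs mD Dfin.
have mF v : measurable (D `&` s @^-1` [set v]).
  by apply: measurableI => //; exact: vsimple_measurable.
have Ffin v : (mu (D `&` s @^-1` [set v]) < +oo)%E.
  exact: (sub_measure_fin (mF v) mD Dfin (@subIsetl _ _ _)).
apply: EFin_inj; rewrite -sumEFin -(fineK_measure Dfin).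
under eq_bigr do rewrite -(fineK_measure (Ffin _)).
have := ge0_integral_bigsetU mu mF urs (@fibers_trivIset _ s D _)
  (f := cst 1%E).
rewrite /= -(fibers_cover D srs) => /(_ (measurable_cst _) (fun _ _ => lee01)).
rewrite integral_cst// mul1e => ->.
by apply: eq_bigr => v _; rewrite integral_cst// mul1e.
Qed.

(** On the joint fibres [P v w] both functions are constant, and all three integrals become sums
    over the same pairs. *)
Lemma simple_integral_dist (V : normedModType R) (s t : X -> V) D :
  vsimple s -> vsimple t -> measurable D -> (mu D < +oo)%E ->
  (`|simple_integral mu D s - simple_integral mu D t|%:E <=
   \int[mu]_(x in D) `|s x - t x|%:E)%E.
Proof.
move=> ss st mD Dfin.
have [rs [urs srs ->]] := vsimple_enum ss.
have [rt [urt trt ->]] := vsimple_enum st.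
pose P v w := (D `&` s @^-1` [set v]) `&` t @^-1` [set w].
have mS v : measurable (D `&` s @^-1` [set v]).
  by apply: measurableI => //; exact: vsimple_measurable.
have mT v : measurable (D `&` t @^-1` [set v]).
  by apply: measurableI => //; exact: vsimple_measurable.
have Sfin v : (mu (D `&` s @^-1` [set v]) < +oo)%E.
  exact: (sub_measure_fin (mS v) mD Dfin (@subIsetl _ _ _)).
have Tfin v : (mu (D `&` t @^-1` [set v]) < +oo)%E.
  exact: (sub_measure_fin (mT v) mD Dfin (@subIsetl _ _ _)).
have mP v w : measurable (P v w).
  by apply: measurableI => //; exact: vsimple_measurable.
have Pfin v w : (mu (P v w) < +oo)%E.
  exact: (sub_measure_fin (mP v w) (mS v) (Sfin v) (@subIsetl _ _ _)).
have sE : \sum_(v <- rs) m (D `&` s @^-1` [set v]) *: v =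
    \sum_(v <- rs) \sum_(w <- rt) m (P v w) *: v.
  apply: eq_bigr => v _; rewrite -scaler_suml; congr (_ *: _).
  exact: fine_measure_fibers.
have tE : \sum_(w <- rt) m (D `&` t @^-1` [set w]) *: w =
    \sum_(v <- rs) \sum_(w <- rt) m (P v w) *: w.
  rewrite exchange_big; apply: eq_bigr => w _.
  rewrite -scaler_suml; congr (_ *: _).
  rewrite (@fine_measure_fibers _ _ _ (D `&` t @^-1` [set w]) ss urs srs)//.
  by apply: eq_bigr => v _; rewrite /P setIAC.
have mst : measurable_fun setT (fun x => `|s x - t x|%:E).
  apply/measurable_EFinP; apply: smeasurable_norm.
  by apply: smeasurableB; exact: smeasurable_simple.
have mstA (A : set X) : measurable_fun A (fun x => `|s x - t x|%:E).
  exact: (@measurable_funS _ _ _ _ setT).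
have -> : (\int[mu]_(x in D) `|s x - t x|%:E)%E =
    \sum_(v <- rs) \sum_(w <- rt) (m (P v w) * `|v - w|)%:E.
  rewrite {1}(fibers_cover D srs) ge0_integral_bigsetU//; last first.
    exact: fibers_trivIset.
  apply: eq_bigr => v _.
  rewrite {1}(fibers_cover (D `&` _) trt) ge0_integral_bigsetU//;
    do ?[exact: fibers_trivIset | by move=> w; exact: mP].
  apply: eq_bigr => w _.
  rewrite (eq_integral (cst `|v - w|%:E)).
    rewrite integral_cst; last exact: mP.
    rewrite [RHS]EFinM muleC; congr (_ * _)%E.
    exact: fineK_measure (Pfin v w).
  by move=> x; rewrite inE => -[[_ /= ->] ->].
rewrite sE tE -sumrB (le_trans (y := (\sum_(v <- rs)
    `|\sum_(w <- rt) m (P v w) *: v - \sum_(w <- rt) m (P v w) *: w|)%:E))//.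
  by rewrite lee_fin; exact: ler_norm_sum.
rewrite -sumEFin; apply: lee_sum => v _.
rewrite sumEFin lee_fin -sumrB; apply: (le_trans (ler_norm_sum _ _ _)).
apply: ler_sum => w _; rewrite -scalerBr normrZ ger0_norm//.
Qed.

Lemma simple_integral_cst (V : normedModType R) (u : V) D :
  simple_integral mu D (cst u) = m D *: u.
Proof.
(* On an empty [X] the range of [cst u] is empty instead of [[set u]]. *)
have [[x _]|X0] := pselect (exists x : X, True); last first.
  have D0 : D = set0 by apply/seteqP; split => // x; exfalso; apply: X0; exists x.
  rewrite /simple_integral D0 measure0 scale0r fsbig1// => v _.
  by rewrite set0I measure0 scale0r.
rewrite /simple_integral (_ : range (cst u) = [set u]); last first.
  by apply/seteqP; split=> [_ [? _ <-]//|_ ->]; exists x.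
rewrite fsbig_set1 (_ : cst u @^-1` [set u] = setT) ?setIT//.
by apply/seteqP; split.
Qed.

(** The approximating simple functions are compared with the simple function [cst u], then the limit
    is taken. Any admissible [v] is covered, in particular the one that [get] picks. *)
Lemma is_bochner_dist (V : normedModType R) (f : X -> V) (v u : V) D :
  smeasurable f -> measurable D -> (mu D < +oo)%E -> is_bochner mu D f v ->
  (`|v - m D *: u|%:E <= \int[mu]_(x in D) `|f x - u|%:E)%E.
Proof.
move=> mf mD Dfin [s [ss _ fs sv]].
have mn (g : X -> V) : smeasurable g -> measurable_fun D (fun x => `|g x|%:E).
  move=> mg; apply/measurable_EFinP; apply: (@measurable_funS _ _ _ _ setT) => //.
  exact: smeasurable_norm.
have mfs n : measurable_fun D (fun x => `|f x - s n x|%:E).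
  by apply/mn/smeasurableB => //; exact: smeasurable_simple.
have mfu : measurable_fun D (fun x => `|f x - u|%:E).
  by apply/mn/smeasurableB => //; exact/smeasurable_simple/vsimple_cst.
have step n : (`|simple_integral mu D (s n) - m D *: u|%:E <=
    \int[mu]_(x in D) `|f x - s n x|%:E + \int[mu]_(x in D) `|f x - u|%:E)%E.
  rewrite -(simple_integral_cst u).
  apply: (le_trans (simple_integral_dist (ss n) (vsimple_cst u) mD Dfin)).
  rewrite -ge0_integralD//; apply: ge0_le_integral => //.
  - apply/mn/smeasurableB; first exact/smeasurable_simple.
    exact/smeasurable_simple/vsimple_cst.
  - exact: emeasurable_funD.
  - move=> x _; rewrite -EFinD lee_fin (distrC (f x) (s n x)).
    exact: ler_distD.
set J := (\int[mu]_(x in D) `|f x - u|%:E)%E in step *.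
have : ((fun n => `|simple_integral mu D (s n) - m D *: u|%:E) @ \oo -->
    `|v - m D *: u|%:E)%E.
  apply/cvg_EFin; first by apply: nearW.
  apply: cvg_norm; apply: cvgB => //; exact: cvg_cst.
move=> h1.
have h2 : ((fun n => \int[mu]_(x in D) `|f x - s n x|%:E + J) @ \oo --> (0 + J))%E.
  apply: cvgeD => //; last exact: cvg_cst.
rewrite -[leRHS]add0e -(cvg_lim _ h2)// -(cvg_lim _ h1)//.
apply: lee_lim; [by apply/cvg_ex; eexists; exact: h1|
  by apply/cvg_ex; eexists; exact: h2|].
by apply: nearW => n; exact: step.
Qed.

End bochner.

(** * Closure properties of L^r and existence of Bochner integrals *)

Section Lr_closure.
Context {R : realType} {d : measure_display} {X : measurableType d}.
Variables (mu : {measure set X -> \bar R}) (r : R).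
Hypothesis r_ge1 : 1 <= r.
Implicit Types (A D : set X).

Lemma integral_restr (V : normedModType R) (f : X -> V) A D :
  (\int[mu]_(x in A) (`|restr f D x| `^ r)%:E =
   \int[mu]_(x in A `&` D) (`|f x| `^ r)%:E)%E.
Proof.
rewrite integral_mkcondr; apply: eq_integral => x _; rewrite patchE.
case: ifPn => [/set_mem Dx|/negP nD]; first by rewrite restrE.
rewrite restrNE; last by move=> Dx; apply: nD; rewrite inE.
by rewrite normr0 powR0// gt_eqF// (lt_le_trans ltr01).
Qed.

Lemma Lr_restr (V : normedModType R) (f : X -> V) D :
  measurable D -> Lr mu r f -> Lr mu r (restr f D).
Proof.
move=> mD [mf fint]; have mrf := smeasurable_restr mD mf; split; first exact: mrf.
apply: le_lt_trans fint; apply: integral_pow_le => // x _.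
exact: norm_restr_le.
Qed.

Lemma Lr_restr_cst (V : normedModType R) (u : V) D :
  measurable D -> (mu D < +oo)%E -> Lr mu r (restr (cst u) D).
Proof.
move=> mD Dfin; split.
  exact/(smeasurable_restr mD)/smeasurable_simple/vsimple_cst.
rewrite integral_restr setTI (eq_integral (cst (`|u| `^ r)%:E))//.
by rewrite integral_cst// (fineK_measure Dfin) -EFinM ltry.
Qed.

Lemma LrB (V : normedModType R) (f g : X -> V) :
  Lr mu r f -> Lr mu r g -> Lr mu r (fun x => f x - g x).
Proof.
move=> [mf fint] [mg gint]; have mfg := smeasurableB mf mg; split; first exact: mfg.
have mpf := measurable_norm_powR r (A := setT) mf.
have mpg := measurable_norm_powR r (A := setT) mg.
apply: (@le_lt_trans _ _ (\int[mu]_x ((2 `^ r)%:E *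
   ((`|f x| `^ r)%:E + (`|g x| `^ r)%:E)))%E).
  apply: ge0_le_integral => //.
  - exact: measurable_norm_powR.
  - by apply: measurable_funeM; exact: emeasurable_funD.
  move=> x _; rewrite -EFinD -EFinM lee_fin.
  apply: le_trans (powR_addl r_ge1 (normr_ge0 _) (normr_ge0 _)).
  by apply: powR_le => //; exact: ler_normB.
rewrite ge0_integralZl//; last 2 first.
- exact: emeasurable_funD.
- by move=> x _; rewrite -EFinD lee_fin addr_ge0 ?powR_ge0.
rewrite ge0_integralD//.
apply: lte_mul_pinfty; [by rewrite lee_fin powR_ge0|by []|].
exact: lte_add_pinfty.
Qed.

Lemma Lr_restrB_cst (V : normedModType R) (f : X -> V) (u : V) D :
  measurable D -> (mu D < +oo)%E -> Lr mu r f ->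
  Lr mu r (restr (fun x => f x - u) D).
Proof.
move=> mD Dfin Lf.
rewrite (_ : restr _ D = fun x => restr f D x - restr (cst u) D x); last first.
  by apply/funext => x; rewrite /restr scalerBr.
by apply: LrB; [exact: Lr_restr|exact: Lr_restr_cst].
Qed.

Lemma Lr_integrable (V : normedModType R) (f : X -> V) D :
  measurable D -> (mu D < +oo)%E -> Lr mu r f ->
  (\int[mu]_(x in D) `|f x|%:E < +oo)%E.
Proof.
move=> mD Dfin [mf fint].
have mpf := measurable_norm_powR r (A := D) mf.
apply: (@le_lt_trans _ _ (\int[mu]_(x in D)
    (cst 1%E x + (`|f x| `^ r)%:E))%E).
  apply: ge0_le_integral => //.
  - apply/measurable_EFinP; apply: (@measurable_funS _ _ _ _ setT) => //.
    exact: smeasurable_norm.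
  - exact: emeasurable_funD.
  move=> x _; rewrite -EFinD lee_fin.
  have [f1|/ltW f1] := leP `|f x| 1; first by rewrite (le_trans f1)// lerDl powR_ge0.
  by rewrite (le_trans (le1r_powR f1 r_ge1))// lerDr.
rewrite ge0_integralD// integral_cst// mul1e lte_add_pinfty//.
apply: le_lt_trans fint; apply: ge0_subset_integral => //.
exact: measurable_norm_powR.
Qed.

(** Truncated simple approximants converge to [f] in L^1 on [D] by dominated convergence, so their
    integrals form a Cauchy sequence, which converges by completeness of [V]. *)
Lemma bochner_ex (V : completeNormedModType R) (f : X -> V) D :
  measurable D -> (mu D < +oo)%E -> Lr mu r f -> exists v, is_bochner mu D f v.
Proof.
move=> mD Dfin Lf; have [[s0 [ss0 s0f]] _] := Lf; have [mf _] := Lf.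
have mn (g : X -> V) : smeasurable g -> measurable_fun D (fun x => `|g x|%:E).
  move=> mg; apply/measurable_EFinP; apply: (@measurable_funS _ _ _ _ setT) => //.
  exact: smeasurable_norm.
(* The truncation gives the integrable majorant 3 |f|. *)
pose E n := [set x | `|s0 n x| <= 2 * `|f x|].
have mE n : measurable (E n).
  rewrite (_ : E n = (fun x => `|s0 n x| <= 2 * `|f x|) @^-1` [set true]); last first.
    by apply/seteqP; split=> x.
  rewrite -[X in measurable X]setTI.
  apply: (@measurable_fun_ler _ _ _ setT (fun x => `|s0 n x|)
    (fun x => 2 * `|f x|)) => //.
    exact/smeasurable_norm/smeasurable_simple.
  by apply: measurable_funM => //; exact: smeasurable_norm.
pose s n := restr (s0 n) (E n).
have ss n : vsimple (s n).
  exact: (vsimple_comp2 (fun (a : R^o) (v : V) => a *: v) (vsimple_indic (mE n)) (ss0 n)).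
have mfs n : smeasurable (fun x => f x - s n x).
  by apply: smeasurableB => //; exact: smeasurable_simple.
(* Where truncation sets the value to 0, [s0 n x] has norm above [2 |f x|], hence is farther from
   [f x] than 0 is. *)
have fs_le n x : `|f x - s n x| <= `|f x - s0 n x|.
  rewrite /s; have [Ex|nE] := pselect (E n x); first by rewrite restrE.
  rewrite restrNE// subr0.
  have : `|s0 n x| <= `|f x| + `|f x - s0 n x|.
    rewrite -[X in `|X| <= _](subrKC (f x)) distrC.
    exact: ler_normD.
  by move/negP: nE; rewrite -ltNge; lra.
have s_le n x : `|f x - s n x| <= 3 * `|f x|.
  rewrite /s; have [Ex|nE] := pselect (E n x).
    by rewrite restrE//; have := ler_normB (f x) (s0 n x); move: Ex; rewrite /E/=; lra.
  by rewrite restrNE// subr0; have := normr_ge0 (f x); lra.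
have fs0 : (fun n => \int[mu]_(x in D) `|f x - s n x|%:E)%E @ \oo --> 0%E.
  have -> : 0%E = (\int[mu]_(x in D) cst 0%E x)%E by rewrite integral0.
  apply: (@dominated_cvg _ _ _ _ _ mD _ _ (fun x => (3 * `|f x|)%:E)) => //.
  - by move=> n; exact: mn.
  - move=> x Dx; apply/cvg_EFin; first exact: nearW.
    apply: (@squeeze_cvgr _ _ _ _ (fun=> 0) (fun n => `|f x - s0 n x|)).
    - by apply: nearW => n /=; rewrite normr_ge0 fs_le.
    - exact: cvg_cst.
    - rewrite -[X in _ --> X](normr0 V) -[X in `|X|](subrr (f x)).
      by apply: cvg_norm; apply: cvgB; [exact: cvg_cst|exact: s0f].
  - apply/integrableP; split.
      by under eq_fun do rewrite EFinM; apply: measurable_funeM; exact: mn.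
    under eq_integral do rewrite gee0_abs ?lee_fin ?mulr_ge0// EFinM.
    rewrite ge0_integralZl//; last exact: mn.
    by rewrite lte_mul_pinfty// Lr_integrable.
  - by move=> n x Dx; rewrite gee0_abs ?lee_fin.
have : cvg ((fun n => simple_integral mu D (s n)) @ \oo).
  apply: cauchy_cvg; apply: cauchy_exP => e e0.
  have e20 : 0 < e / 2 by lra.
  have /(_ _ e20)[N _ hN] : forall e : R, 0 < e -> \forall n \near \oo,
      (\int[mu]_(x in D) `|f x - s n x|%:E < e%:E)%E.
    move=> e' e'0; apply: (fs0 [set y | (y < e'%:E)%E]).
    by apply: open_nbhs_nbhs; split; [exact: open_ereal_lt_ereal|rewrite /= lte_fin].
  exists (simple_integral mu D (s N)); exists N => // n Nn.
  rewrite -ball_normE/= -lte_fin.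
  apply: (le_lt_trans (simple_integral_dist (ss N) (ss n) mD Dfin)).
  have mfsD k : measurable_fun D (fun x => `|f x - s k x|%:E) by exact: mn.
  apply: (@le_lt_trans _ _ (\int[mu]_(x in D)
    (`|f x - s N x|%:E + `|f x - s n x|%:E))%E).
    apply: ge0_le_integral => //.
    - by apply/mn/smeasurableB; exact: smeasurable_simple.
    - exact: emeasurable_funD.
    - move=> x _; rewrite -EFinD lee_fin (distrC (f x) (s N x)).
      exact: ler_distD.
  rewrite ge0_integralD// (splitr e) EFinD; apply: lteD; last exact: hN.
  by apply: hN => /=.
move=> /cvg_ex[v sv]; exists v, s; split => // n.
apply: (sub_measure_fin _ mD Dfin (@subIsetl _ D _)).
apply: (measurableI _ _ mD).
exact: (vsimple_measurable [set w | w != 0] (ss n)).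
Qed.

End Lr_closure.

(** * Oscillation of the maximal operator *)

Section oscillation.
Context {R : realType} {d : measure_display} {X : measurableType d}.
Variable mu : {measure set X -> \bar R}.

(** The infimum is attained: unite the null sets belonging to the bounds y + 1/(n+1). *)
Lemma OSC_leP (V : normedModType R) (E : set X) (g : X -> V) (y : R) :
  (OSC mu E g <= y%:E)%E <-> exists2 N, mu.-negligible N &
    forall x x', (E `\` N) x -> (E `\` N) x' -> `|g x - g x'| <= y.
Proof.
split=> [Ey|[N N0 EN]]; last first.
  apply: ereal_inf_lbound; exists N; first exact: N0.
  by move=> x x' Ex Ex'; rewrite lee_fin; exact: EN.
have H (n : nat) : exists N, mu.-negligible N /\
    forall x x', (E `\` N) x -> (E `\` N) x' -> `|g x - g x'| <= y + n.+1%:R^-1.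
  have /ereal_inf_lt[z [N N0 Nz] zy] : (OSC mu E g < (y + n.+1%:R^-1)%:E)%E.
    by apply: (le_lt_trans Ey); rewrite lte_fin ltrDl invr_gt0.
  exists N; split => // x x' Ex Ex'.
  by rewrite -lee_fin; apply: (le_trans (Nz _ _ Ex Ex')); exact: ltW.
have [N NP] := choice H; exists (\bigcup_n N n).
  by apply: negligible_bigcup => n; have [] := NP n.
move=> x x' [Ex nx] [Ex' nx']; apply/ler_addgt0Pr => e e0.
have [n ne] : exists n : nat, n.+1%:R^-1 < e.
  by exists (Num.truncn e^-1); rewrite invf_plt ?posrE//; exact: truncnS_gt.
have [_ /(_ x x')] := NP n.
have Nx z : ~ (\bigcup_n N n) z -> ~ N n z by move=> + Nz; apply; exists n.
move=> /(_ (conj Ex (Nx _ nx)) (conj Ex' (Nx _ nx'))) /le_trans; apply.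
by rewrite lerD2l ltW.
Qed.

(** If [h < a] on a non-null part of [E], each [u i] is at most [a + b] almost everywhere on [E].
    Lowering [h] to [a + b] on [E] then leaves an upper bound of the family, so by minimality
    [h <= a + b] almost everywhere on [E]. The null sets depending on [i] are never united. *)
Lemma OSC_L0_sup (J : Type) (u : J -> X -> R) (h : X -> R^o) (E : set X)
    (b : R) : is_L0_sup mu u h -> measurable E ->
  (forall i, exists2 N, mu.-negligible N &
    forall x x', (E `\` N) x -> (E `\` N) x' -> u i x <= u i x' + b) ->
  (OSC mu E h <= b%:E)%E.
Proof.
move=> [mh uh hmin] mE uE.
pose Elt (a : R) := E `&` [set x | h x < a].
have mElt a : measurable (Elt a).
  apply: measurableI => //.
  rewrite (_ : [set x | _] = (fun x => h x < a) @^-1` [set true]); last first.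
    by apply/seteqP; split=> x.
  rewrite -[X in measurable X]setTI.
  by apply: (@measurable_fun_ltr _ _ _ setT h (cst a)).
have key a : ~ mu.-negligible (Elt a) ->
    mu.-negligible (E `&` [set x | a + b < h x]).
  move=> nE.
  (* a smaller upper bound than h if h exceeds a + b on E *)
  pose k x := if x \in E then Num.min (h x) (a + b) else h x.
  have mk : measurable_fun setT k.
    apply: measurable_fun_ifT => //; last by apply: measurable_minr.
    apply: (@measurable_fun_bool _ _ _ _ true); rewrite setTI.
    rewrite (_ : _ @^-1` _ = E)//.
    by apply/seteqP; split=> x /=; [exact: set_mem|exact: mem_set].
  have uk i : \forall x \ae mu, u i x <= k x.
    have [N N0 NE] := uE i.
    have uhi := uh i.
    have [x' [Ex' hx'] nN] : exists2 x', Elt a x' &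
        ~ (N `|` ~` [set x | u i x <= h x]) x'.
      apply: contrapT => nex; apply: nE.
      apply: (@negligibleS _ _ _ _ (N `|` ~` [set x | u i x <= h x])).
        by move=> x Ex; apply: contrapT => nx; apply: nex; exists x.
      exact: negligibleU.
    have ux' : u i x' <= h x' by apply: contrapT => hh; apply: nN; right.
    apply: (@negligibleS _ _ _ _ (N `|` ~` [set x | u i x <= h x])); last first.
      exact: negligibleU.
    move=> x nkx; apply: contrapT => nx; apply: nkx => /=.
    have ux : u i x <= h x by apply: contrapT => hh; apply: nx; right.
    rewrite /k; case: ifPn => // /set_mem Ex.
    rewrite le_min ux/=; apply: (@le_trans _ _ (u i x' + b)).
      by apply: NE; split => // ?; [apply: nx|apply: nN]; left.
    by rewrite lerD2r (le_trans ux')// ltW.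
  have := hmin _ mk uk; apply: negligibleS => x [Ex hx] /=.
  by rewrite /k mem_set// le_min lexx/= leNgt hx.
apply/OSC_leP.
(* Rational levels suffice and give countably many null sets: if [h x' < q < h x - b], one of [x],
   [x'] lies in [Bad q]. *)
pose Bad (q : rat) := [set x | (Elt (ratr q) x /\ mu.-negligible (Elt (ratr q)))
  \/ [/\ E x, ratr q + b < h x & ~ mu.-negligible (Elt (ratr q))]].
pose Badn n := if unpickle n is Some q then Bad q else set0.
exists (\bigcup_n Badn n).
  apply: negligible_bigcup => n; rewrite /Badn.
  case: unpickle => [q|]; last exact: negligible_set0.
  have [ne|nne] := pselect (mu.-negligible (Elt (ratr q))).
    by apply: (negligibleS _ ne) => x [[]//|[_ _]].
  by apply: (negligibleS _ (key _ nne)) => x [[_]//|[]].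
suff one x x' : (E `\` \bigcup_n Badn n) x ->
    (E `\` \bigcup_n Badn n) x' -> h x <= h x' + b.
  move=> x x' Hx Hx'; rewrite ler_norml.
  by have := one _ _ Hx Hx'; have := one _ _ Hx' Hx; lra.
move=> [Ex nx] [Ex' nx']; rewrite leNgt; apply/negP => lt.
have /rat_in_itvoo[q] : h x' < h x - b by lra.
rewrite in_itv/= => /andP[q1 q2].
have nB z : ~ (\bigcup_n Badn n) z -> ~ Bad q z.
  have qn : Badn (pickle q) = Bad q by rewrite /Badn pickleK.
  by move=> + Bz; apply; exists (pickle q); [exact: I|rewrite qn].
have [ne|nne] := pselect (mu.-negligible (Elt (ratr q))).
  by apply: (nB _ nx'); left.
by apply: (nB _ nx); right; split => //; lra.
Qed.

End oscillation.

(** * Growth of the means along balls *)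

Section means.
Context {R : realType} {d : measure_display} {X : measurableType d}.
Variables (mu : {measure set X -> \bar R}) (balls : set (set X)) (K eta r : R).
Hypothesis bb : ball_basis mu balls K.
Hypothesis dbl : doubling mu balls eta.
Hypothesis K_ge1 : 1 <= K.
Hypothesis eta_gt1 : 1 < eta.
Hypothesis r_ge1 : 1 <= r.
Context {U : completeNormedModType R}.
Variable f : X -> U.
Hypothesis Lf : Lr mu r f.
Implicit Types A B C E F Q : set X.

Local Notation star := (ball_star mu balls).
Local Notation m A := (fine (mu A)).

Let mball := B1_measurable bb.

Let sm_cst (c : U) : smeasurable (fun x => f x - c).
Proof.
apply: smeasurableB; first by case: Lf.
exact/smeasurable_simple/vsimple_cst.
Qed.

(** The left side is at most the integral over [A] of the norm of [f - mean mu f C], and this is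
    enlarged to [C]; the 2 is that of [avg_integral_norm]. *)
Lemma mean_dist A C (s : R) : balls A -> balls C -> A `<=` C -> 0 < s ->
  (sharp_avg mu r f C <= s%:E)%E ->
  `|mean mu f A - mean mu f C| * m A <= 2 * s * m C.
Proof.
move=> bA bC AC s0 sC; have [mA mC] := (mball bA, mball bC).
have [Afin Cfin] := (B1_fin bb bA, B1_fin bb bC).
have A0 := ball_measure_gt0 bb bA.
have hb : is_bochner mu A f (bochner mu A f).
  exact: (getPex (bochner_ex r_ge1 mA Afin Lf)).
have A_neq0 : m A != 0 by rewrite gt_eqF.
set u := mean mu f C in sC *.
have -> : `|mean mu f A - u| * m A = `|bochner mu A f - m A *: u|.
  rewrite (_ : _ - m A *: u = m A *: (mean mu f A - u)).
    by rewrite normrZ mulrC (ger0_norm (ltW A0)).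
  by rewrite scalerBr /mean (scalerA (m A) (m A)^-1) mulfV// scale1r.
rewrite -lee_fin; apply: (le_trans (is_bochner_dist u (proj1 Lf) mA Afin hb)).
apply: le_trans (avg_integral_norm r_ge1 mC (B1_gt0 bb bC) Cfin (sm_cst _) s0 sC).
apply: ge0_subset_integral => //; apply/measurable_EFinP.
apply: (@measurable_funS _ _ _ _ setT) => //.
exact: smeasurable_norm (sm_cst _).
Qed.

(* B grows at least by a factor 2 at each step until its measure is comparable
   to that of A, or until it may be replaced by the whole space. *)
Lemma mean_chain n B A (s : R) : balls B -> balls A -> A `&` B !=set0 ->
  m B <= eta * K * m A -> m A <= 2 ^+ n.+1 * m B -> 0 < s ->
  (forall C, balls C -> B `<=` C -> (sharp_avg mu r f C <= s%:E)%E) ->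
  `|mean mu f A - mean mu f B| <= 4 * eta * K ^+ 2 * n.+1%:R * s.
Proof.
have K0 : 0 < K by move: K_ge1; lra.
have e0 : 0 < eta by move: eta_gt1; lra.
have eK : 1 <= eta * K by apply: mulr_ege1 => //; exact: ltW.
have dist A' C' (c t : R) : balls A' -> balls C' -> A' `<=` C' -> 0 < t ->
    (sharp_avg mu r f C' <= t%:E)%E -> m C' <= c * m A' ->
    `|mean mu f A' - mean mu f C'| <= 2 * c * t.
  move=> bA bC AC t0 tC cC; have A0 := ball_measure_gt0 bb bA.
  rewrite -(ler_pM2r A0); apply: (le_trans (mean_dist bA bC AC t0 tC)).
  rewrite [leRHS](_ : _ = 2 * t * (c * m A')); last by ring.
  by rewrite ler_wpM2l// mulr_ge0// ltW.
(* Balls of comparable size are both compared with a ball [Q] containing [star B'], at cost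
   [2 * eta * K ^+ 2] and [2 * K]. *)
have base B' A' (t : R) : balls B' -> balls A' -> A' `&` B' !=set0 ->
    m B' <= eta * K * m A' -> m A' <= 2 * m B' -> 0 < t ->
    (forall C, balls C -> B' `<=` C -> (sharp_avg mu r f C <= t%:E)%E) ->
    `|mean mu f A' - mean mu f B'| <= 4 * eta * K ^+ 2 * t.
  move=> bB bA AB BA AB2 t0 st.
  have [Q [bQ sBQ BQ mQ]] := ball_starP bb bB.
  have AQ : A' `<=` Q.
    apply: subset_trans sBQ; apply: ball_star_sub => //.
    by rewrite (ball_measureE bb bA) (ball_measureE bb bB) -EFinM lee_fin.
  have h1 := dist A' Q (K * (eta * K)) t bA bQ AQ t0 (st _ bQ BQ).
  have h2 := dist B' Q K t bB bQ BQ t0 (st _ bQ BQ) mQ.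
  have {}h1 : `|mean mu f A' - mean mu f Q| <= 2 * (K * (eta * K)) * t.
    by apply: h1; apply: (le_trans mQ); rewrite -mulrA ler_pM2l.
  apply: (le_trans (ler_distD (mean mu f Q) _ _)).
  rewrite (distrC (mean mu f Q)); apply: (le_trans (lerD h1 h2)).
  rewrite -mulrDl ler_wpM2r ?(ltW t0)//.
  suff : K <= K * (eta * K) by move=> ?; rewrite expr2; nra.
  by rewrite ler_peMr// ltW.
elim: n B => [|n IH] B bB bA AB BA AB2 s0 sB.
  by rewrite mulr1; apply: base.
have c0 : 0 <= 4 * eta * K ^+ 2 by rewrite !mulr_ge0 ?sqr_ge0 ?ltW.
have Kle : K <= eta * K by rewrite ler_peMl ?ltW.
have KK : K ^+ 2 <= eta * K ^+ 2 by rewrite ler_peMl ?sqr_ge0 ?ltW.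
have [AB1|/ltW BA1] := leP (m A) (2 * m B).
  apply: (le_trans (base B A s bB bA AB BA AB1 s0 sB)).
  by rewrite ler_wpM2r ?(ltW s0)// ler_peMr// ler1n.
have B0 := ball_measure_gt0 bb bB.
(* Here [m B] is at most [m A], so [B1] still satisfies [m B1 <= eta * K * m A], while one power of
   2 is gained. If growth ends at [setT], both means are compared with the mean over [setT]. *)
have [[B1 [bB1 BB1 h1 h2]]|[bT hT]] := ball_growth bb dbl K_ge1 eta_gt1 bB.
  have d1 := dist B B1 (eta * K) s bB bB1 BB1 s0 (sB _ bB1 BB1) h2.
  have d2 : `|mean mu f A - mean mu f B1| <= 4 * eta * K ^+ 2 * n.+1%:R * s.
    apply: IH => //.
    - by case: AB => x [Ax Bx]; exists x; split => //; exact: BB1.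
    - by apply: (le_trans h2); rewrite ler_wpM2l; lra.
    - apply: (le_trans AB2); rewrite (exprSr 2 n.+1) -(mulrA _ 2).
      by rewrite ler_wpM2l// exprn_ge0.
    - by move=> C bC B1C; apply: sB => //; exact: subset_trans B1C.
  apply: (le_trans (ler_distD (mean mu f B1) _ _)).
  rewrite (distrC (mean mu f B1)); apply: (le_trans (lerD d2 d1)).
  rewrite -mulrDl ler_wpM2r ?(ltW s0)// -(natr1 n.+1) mulrDr mulr1 lerD2l.
  rewrite expr2 (_ : 4 * eta * _ = 2 * (eta * K) * (2 * K)); last by ring.
  by rewrite ler_peMr//; move: K_ge1 eK; lra.
have BT := sB _ bT (@subsetT _ _).
have d1 := dist B setT (K ^+ 2) s bB bT (@subsetT _ _) s0 BT hT.
have d2 : `|mean mu f A - mean mu f setT| <= 2 * K ^+ 2 * s.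
  apply: dist => //; apply: (le_trans hT); rewrite ler_wpM2l ?sqr_ge0//.
  lra.
apply: (le_trans (ler_distD (mean mu f setT) _ _)).
rewrite (distrC (mean mu f setT)); apply: (le_trans (lerD d2 d1)).
rewrite -mulrDl ler_wpM2r ?(ltW s0)//; apply: (@le_trans _ _ (4 * eta * K ^+ 2)).
  by move: KK; lra.
by rewrite ler_peMr// ler1n.
Qed.

End means.

(** Turns the number of steps in [mean_chain] into the logarithm of R4. The factor 2 covers the
    extra step in [n.+1], since [ln 2 <= ln (1 + rho)]. *)
Lemma dyadic_log (R : realType) (rho : R) : 1 <= rho -> exists n : nat,
  rho <= 2 ^+ n.+1 /\ n.+1%:R * ln 2 <= 2 * ln (1 + rho).
Proof.
move=> rho1; have rho0 : 0 <= rho by lra.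
have N0 : (0 < Num.truncn rho)%N by rewrite truncn_gt_nat.
have /andP[n1 n2] := trunc_log_bounds (isT : (1 < 2)%N) N0.
set n := trunc_log 2 _ in n1 n2; exists n.
have le_pow : 2 ^+ n <= rho.
  apply: (@le_trans _ _ (Num.truncn rho)%:R); last by rewrite truncn_le.
  by rewrite -natrX ler_nat.
split.
  apply: (@le_trans _ _ (Num.truncn rho).+1%:R); first exact/ltW/truncnS_gt.
  by rewrite -natrX ler_nat.
have h1 : n%:R * ln 2 <= ln (1 + rho).
  rewrite mulr_natl -lnXn// ler_ln ?posrE ?exprn_gt0//; lra.
have h2 : ln 2 <= ln (1 + rho).
  rewrite ler_ln ?posrE//; lra.
by rewrite -natr1 mulrDl mul1r; lra.
Qed.

(** * Exhaustion of the space by balls *)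

Section exhaustion.
Context {R : realType} {d : measure_display} {X : measurableType d}.
Variables (mu : {measure set X -> \bar R}) (balls : set (set X)) (K : R).
Hypothesis bb : ball_basis mu balls K.
Implicit Types A B C E F Q : set X.

Local Notation m A := (fine (mu A)).

Let mball := B1_measurable bb.

(** B3 for the whole space with errors 1/(n+1) gives countably many balls covering almost
    everything; joining them one after another makes the sequence increasing. *)
Lemma ball_exhaustion B : balls B -> exists G : nat -> set X,
  [/\ forall n, balls (G n), forall n, B `<=` G n,
      {homo G : k n / (k <= n)%N >-> k `<=` n} & mu (~` \bigcup_n G n) = 0%E].
Proof.
move=> bB.
have inv0 (n : nat) : 0 < n.+1%:R^-1 :> R by rewrite invr_gt0.
have [F FP] := choice (fun n : nat => B3 bb measurableT (inv0 n)).
pose D := \bigcup_n F n.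
have cD : countable D.
  by apply: bigcup_countable => // n _; have [] := FP n.
have Db : D `<=` balls by move=> C [n _ FC]; have [_ h _] := FP n; exact: h.
have /countable_injP[f finj] := cD.
have [u uP] : exists u : nat -> set X, (forall n, balls (u n)) /\ D `<=` range u.
  have ex (n : nat) : exists C, balls C /\ forall C', D C' -> f C' = n -> C' = C.
    have [[C DC fC]|nD] := pselect (exists2 C, D C & f C = n); last first.
      by exists B; split => // C' DC' fC'; exfalso; apply: nD; exists C'.
    exists C; split; first exact: Db.
    by move=> C' DC' fC'; apply: finj; rewrite ?inE// fC' fC.
  have [u uP] := choice ex; exists u; split=> [n|C DC]; first by case: (uP n).
  by exists (f C) => //; have [_ /(_ C DC erefl)] := uP (f C).
have [ub uD] := uP.
have join (p : set X * set X) : exists Q, balls p.1 -> balls p.2 ->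
    [/\ balls Q, p.1 `<=` Q & p.2 `<=` Q].
  have [b1|] := pselect (balls p.1); last by exists set0.
  have [b2|] := pselect (balls p.2); last by exists set0.
  by have [Q h] := ball_join bb b1 b2; exists Q.
have [J JP] := choice join.
pose G := fix G n := if n is k.+1 then J (G k, u k) else B.
have bG n : balls (G n).
  elim: n => //= n IH; by have [] := JP (G n, u n) IH (ub n).
have GS n : G n `<=` G n.+1 by have [] := JP (G n, u n) (bG n) (ub n).
have uG n : u n `<=` G n.+1 by have [] := JP (G n, u n) (bG n) (ub n).
have Ghomo : {homo G : k n / (k <= n)%N >-> k `<=` n}.
  move=> k n; elim: n => [|n IH]; first by rewrite leqn0 => /eqP->.
  rewrite leq_eqVlt => /predU1P[->//|/IH kn]; exact: subset_trans (GS n).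
exists G; split => //; first by move=> n; exact: (Ghomo 0%N).
have mUG : measurable (\bigcup_n G n).
  by apply: bigcupT_measurable => n; exact: mball.
have small n : (mu (~` \bigcup_n G n) <= (n.+1%:R^-1)%:E)%E.
  have [_ Fb Fn] := FP n; apply: le_trans (ltW Fn).
  apply: measure_mono.
  - exact: measurableC.
  - by apply: measurableU; apply: measurableD => //; exact: (ball_separable bb).
  - move=> x nG; left; split => // -[C FC Cx]; apply: nG.
    have [|k _ kC] := uD C; first by exists n.
    by exists k.+1 => //; apply: uG; rewrite kC.
have fin : (mu (~` \bigcup_n G n) < +oo)%E.
  by apply: le_lt_trans (small 0%N) (ltry _).
rewrite (fineK_measure fin); congr EFin; apply/eqP.
rewrite eq_le fine_ge0// andbT; apply/ler_addgt0Pr => e e0.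
have [n ne] : exists n : nat, n.+1%:R^-1 < e.
  by exists (Num.truncn e^-1); rewrite invf_plt ?posrE//; exact: truncnS_gt.
rewrite add0r -lee_fin -(fineK_measure fin); apply: (le_trans (small n)).
by rewrite lee_fin ltW.
Qed.

(** Monotone convergence along an exhaustion by balls. *)
Lemma integral_tail (h : X -> \bar R) B (e : R) : measurable_fun setT h ->
  (forall x, (0 <= h x)%E) -> (\int[mu]_x h x < +oo)%E -> balls B -> 0 < e ->
  exists Q, [/\ balls Q, B `<=` Q & (\int[mu]_(x in ~` Q) h x <= e%:E)%E].
Proof.
move=> mh h0 hfin bB e0; have [G [bG BG Ghomo G0]] := ball_exhaustion bB.
have mG n : measurable (G n) by exact: mball.
have mUG : measurable (\bigcup_n G n) by exact: bigcupT_measurable.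
have mhA A : measurable_fun A h by exact: (@measurable_funS _ _ _ _ setT).
have split_int A : measurable A ->
    (\int[mu]_x h x = \int[mu]_(x in A) h x + \int[mu]_(x in ~` A) h x)%E.
  move=> mA; rewrite -ge0_integral_setU// ?setUv//; first exact: measurableC.
  by apply/disj_setPS => x [].
have cv : (fun n => \int[mu]_(x in G n) h x)%E @ \oo --> (\int[mu]_x h x)%E.
  have -> : (\int[mu]_x h x = \int[mu]_(x in \bigcup_n G n) h x)%E.
    rewrite (split_int _ mUG) [X in (_ + X)%E]null_set_integral ?adde0//.
    exact: measurableC.
  apply: ge0_nondecreasing_set_cvg_integral => //.
  by move=> k n kn; apply/subsetPset; exact: Ghomo.
have int0 A : (0 <= \int[mu]_(x in A) h x)%E by exact: integral_ge0.
have [I IE] : exists I, (\int[mu]_x h x)%E = I%:E.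
  by exists (fine (\int[mu]_x h x)); rewrite fineK// ge0_fin_numE.
rewrite IE in cv.
have [N _ hN] : \forall n \near \oo, ((I - e)%:E < \int[mu]_(x in G n) h x)%E.
  apply: (cv [set y | ((I - e)%:E < y)%E]).
  apply: open_nbhs_nbhs; split; first exact: open_ereal_gt_ereal.
  by rewrite /= lte_fin; lra.
exists (G N); split => //.
have := hN N (leqnn N); have := split_int _ (mG N); rewrite IE.
have := int0 (G N); have := int0 (~` G N).
case: (\int[mu]_(x in G N) h x)%E => [a| |];
  case: (\int[mu]_(x in ~` G N) h x)%E => [b| |] // _ _.
by rewrite -EFinD => -[->]; rewrite lte_fin lee_fin; lra.
Qed.

End exhaustion.

(** * The far part of a restricted type operator *)

Section restricted_operators.
Context {R : realType} {d : measure_display} {X : measurableType d}.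
Variables (mu : {measure set X -> \bar R}) (balls : set (set X)) (K eta r : R).
Hypothesis bb : ball_basis mu balls K.
Hypothesis dbl : doubling mu balls eta.
Hypothesis K_ge1 : 1 <= K.
Hypothesis eta_gt1 : 1 < eta.
Hypothesis r_ge1 : 1 <= r.
Context {U : completeNormedModType R} {V : normedModType R}.
Variables (S : (X -> U) -> X -> V) (L1 : R).
Hypothesis S_linear : linear_operator mu r S.
Hypothesis L1_ge0 : 0 <= L1.
Hypothesis S_R4 : R4 mu balls r L1 S.
Implicit Types A B C E F Q : set X.

Local Notation star := (ball_star mu balls).
Local Notation m A := (fine (mu A)).

Let mball := B1_measurable bb.

Lemma linear_operatorB f g : Lr mu r f -> Lr mu r g ->
  \forall x \ae mu, S (fun y => f y - g y) x = S f x - S g x.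
Proof.
move=> Lf Lg; have := S_linear (-1) Lg Lf.
rewrite (_ : (fun y => -1 *: g y + f y) = fun y => f y - g y); last first.
  by apply/funext => y; rewrite scaleN1r addrC.
by apply: filterS => x ->; rewrite scaleN1r addrC.
Qed.

(** The inverse logarithm of R4, moved to the other side, allows the averages of [h] to grow
    logarithmically. *)
Lemma R4_bound Q h (t : R) : balls Q -> Lr mu r h ->
  (forall x, star Q x -> h x = 0) ->
  (forall A, balls A -> Q `<=` A ->
    (avg mu r h A <= (t * ln (1 + m A / m Q))%:E)%E) ->
  (OSC mu Q (S h) <= (L1 * t)%:E)%E.
Proof.
move=> bQ Lh h0 ht; have := S_R4 Lh bQ.
have -> : restr h (~` star Q) = h.
  apply/funext => x; have [Qx|nQ] := pselect (star Q x); last by rewrite restrE.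
  by rewrite h0// /restr h0// scaler0.
move=> /le_trans; apply; rewrite EFinM lee_wpmul2l ?lee_fin//.
apply: ge_ereal_sup => _ [A [bA QA] <-].
have Q0 := ball_measure_gt0 bb bQ; have A0 := ball_measure_gt0 bb bA.
have l0 : 0 < ln (1 + m A / m Q) by rewrite ln_gt0// ltrDl divr_gt0.
rewrite muleC -lee_pdivlMr ?invr_gt0//.
by rewrite invrK -EFinM; exact: ht.
Qed.

(** The term with [s] is the genuine far part [G2]; [e] pays for the constant [c] and for the cut at
    a large ball [B3]. *)
Lemma tail_oscillation f Q Q1 (s e : R) :
  (forall (u : U) B (e : R), balls B -> 0 < e ->
    exists B', [/\ balls B', B `<=` B' & forall B'', balls B'' ->
      B' `<=` B'' -> (OSC mu B (S (restr (cst u) B'')) <= e%:E)%E]) ->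
  Lr mu r f -> balls Q -> balls Q1 -> star Q `<=` Q1 -> 0 < s -> 0 < e ->
  (forall C, balls C -> Q `<=` C -> (sharp_avg mu r f C <= s%:E)%E) ->
  exists2 N, mu.-negligible N & forall x x', (Q `\` N) x -> (Q `\` N) x' ->
    let F := restr (fun x => f x - mean mu f Q) Q1 in
    `|S f x - S F x - (S f x' - S F x')| <=
      L1 * (8 / ln 2 * (1 + 4 * eta * K ^+ 2) * s) + e.
Proof.
move=> S_R5 Lf bQ bQ1 sQ s0 e0 sC.
have ln2 : 0 < ln 2 :> R by rewrite ln_gt0// ltr1n.
have Q0 := ball_measure_gt0 bb bQ.
set c := mean mu f Q; pose F := restr (fun x => f x - c) Q1.
have e20 : 0 < e / 2 by rewrite divr_gt0.
have [B1 [bB1 QB1 hB1]] := S_R5 c Q (e / 2) bQ e20.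
have [B2 [bB2 B12 Q12]] := ball_join bb bB1 bQ1.
(* Ensures [L1 * t <= e / 2], also for [L1 = 0]. *)
pose t := e / 2 / (L1 + 1).
have t0 : 0 < t by rewrite divr_gt0//; move: L1_ge0; lra.
have [mf fint] := Lf.
(* With this tail bound the average of [G4] over any ball [A] containing [Q] is at most [t * ln 2],
   and [ln 2 <= ln (1 + m A / m Q)]. *)
have tl0 : 0 < (t * ln 2) `^ r * m Q by rewrite mulr_gt0// powR_gt0// mulr_gt0.
have [|B3 [bB3 B23 tail]] := integral_tail bb
  (measurable_norm_powR r (A := setT) mf) _ fint bB2 tl0.
  by move=> x; rewrite lee_fin powR_ge0.
have Q3 : Q1 `<=` B3 by exact: subset_trans B23.
have [mQ1 mB3] := (mball bQ1, mball bB3).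
(* f = F + G2 + G3 + G4, where G3 is handled by R5 and G4 has small norm. *)
pose G2 := restr (fun x => f x - c) (B3 `\` Q1).
pose G3 := restr (cst c) B3.
pose G4 := restr f (~` B3).
have LF : Lr mu r F by apply: Lr_restrB_cst => //; exact: (B1_fin bb bQ1).
have mD : measurable (B3 `\` Q1) by exact: measurableD.
have Dfin : (mu (B3 `\` Q1) < +oo)%E.
  by apply: sub_measure_fin (B1_fin bb bB3) _ => // x [].
have LG2 : Lr mu r G2 by exact: Lr_restrB_cst.
have LG3 : Lr mu r G3 by apply: Lr_restr_cst => //; exact: (B1_fin bb bB3).
have LG4 : Lr mu r G4 by apply: Lr_restr => //; exact: measurableC.
have fE : (fun x => f x - F x - G2 x - G3 x) = G4.
  apply/funext => x; rewrite /F /G2 /G3 /G4.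
  have [Q1x|nQ1] := pselect (Q1 x).
    have B3x := Q3 _ Q1x.
    rewrite !(restrE _ Q1x) (restrE _ B3x) !restrNE; [|by move=> []|by move=> []].
    by rewrite /cst subr0 subKr subrr.
  have [B3x|nB3] := pselect (B3 x).
    rewrite (restrNE _ nQ1) (restrE _ (conj B3x nQ1 : (B3 `\` Q1) x)).
    rewrite (restrE _ B3x) restrNE; last by move=> /(_ B3x).
    by rewrite subr0 subKr subrr.
  rewrite (restrNE _ nQ1) (restrNE _ nB3) restrNE; last by move=> [].
  by rewrite restrE// !subr0.
have LfF := LrB r_ge1 Lf LF; have LfFG := LrB r_ge1 LfF LG2.
have [N1 [N10 N1P]] : exists N, mu.-negligible N /\ forall x, ~ N x ->
    S f x - S F x = S G2 x + S G3 x + S G4 x.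
  have H := linear_operatorB Lf LF.
  have H' := linear_operatorB LfF LG2.
  have H'' := linear_operatorB LfFG LG3.
  rewrite fE in H''.
  exists (~` [set x | S f x - S F x = S G2 x + S G3 x + S G4 x]); split.
    have : \forall x \ae mu, S f x - S F x = S G2 x + S G3 x + S G4 x.
      near=> x.
      have h : S (fun y => f y - F y) x = S f x - S F x by near: x.
      have h' : S (fun y => f y - F y - G2 y) x =
        S (fun y => f y - F y) x - S G2 x by near: x.
      have h'' : S G4 x = S (fun y => f y - F y - G2 y) x - S G3 x by near: x.
      by rewrite h'' h' h -(addrA (S f x - S F x)) -opprD [RHS]addrC subrK.
    by [].
  by move=> x /contrapT.
(* The average of [G2] over [A] is at most 4 times [s] plus the drift of the mean from [Q] to [A],
   which is linear in [n.+1]; [dyadic_log] turns [n.+1] into a logarithm at the price [2 / ln 2],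
   whence [8 / ln 2]. *)
have [N2 N20 N2P] : exists2 N, mu.-negligible N & forall x x',
    (Q `\` N) x -> (Q `\` N) x' -> `|S G2 x - S G2 x'| <=
      L1 * (8 / ln 2 * (1 + 4 * eta * K ^+ 2) * s).
  apply/OSC_leP; apply: R4_bound => // [x sx|A bA QA].
    by rewrite /G2 restrNE// => -[_]; apply; exact: sQ.
  have A0 := ball_measure_gt0 bb bA.
  have QAm := ball_measure_mono bb bQ bA QA.
  have [n [n1 n2]] : exists n : nat, m A / m Q <= 2 ^+ n.+1 /\
      n.+1%:R * ln 2 <= 2 * ln (1 + m A / m Q).
    by apply: dyadic_log; rewrite ler_pdivlMr// mul1r.
  have eK : 1 <= eta * K by apply: mulr_ege1 => //; exact: ltW.
  have fAc : `|mean mu f A - c| <= 4 * eta * K ^+ 2 * n.+1%:R * s.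
    apply: (mean_chain bb dbl K_ge1 eta_gt1 r_ge1 Lf bQ bA _ _ _ s0 sC).
    - by have [x Qx] := ball_nonempty bb bQ; exists x; split; [exact: QA|].
    - by apply: (le_trans QAm); rewrite ler_peMl// ltW.
    - by rewrite -ler_pdivrMr.
  have eK2 : 0 <= 4 * eta * K ^+ 2.
    by apply: mulr_ge0; [move: eta_gt1; lra|exact: sqr_ge0].
  have smA : smeasurable (fun x => f x - mean mu f A).
    by apply: smeasurableB => //; exact/smeasurable_simple/vsimple_cst.
  apply: le_trans.
    apply: (avg_add r_ge1 (mball bA) (B1_gt0 bb bA) (B1_fin bb bA) (proj1 LG2)
      smA (ltW s0) (normr_ge0 (mean mu f A - c)) _ (sC _ bA QA)).
    move=> x Ax; apply: (le_trans (norm_restr_le _ _ _)).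
    rewrite -[X in `|X| <= _](subrKA (mean mu f A)).
    exact: ler_normD.
  rewrite lee_fin; apply: (@le_trans _ _
      (4 * ((1 + 4 * eta * K ^+ 2) * n.+1%:R * s))).
    rewrite ler_wpM2l// mulrDl mul1r mulrDl lerD//.
    by rewrite ler_peMl ?(ltW s0)// ler1n.
  rewrite [leLHS](_ : _ = 4 / ln 2 * (1 + 4 * eta * K ^+ 2) * s * (n.+1%:R * ln 2)).
    rewrite [leRHS](_ : _ = 4 / ln 2 * (1 + 4 * eta * K ^+ 2) * s *
      (2 * ln (1 + m A / m Q))); last by field; rewrite gt_eqF.
    rewrite ler_wpM2l//; apply: mulr_ge0; last exact: ltW.
    by apply: mulr_ge0; [rewrite divr_ge0// ltW|lra].
  by field; rewrite gt_eqF.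
have [N3 N30 N3P] : exists2 N, mu.-negligible N & forall x x',
    (Q `\` N) x -> (Q `\` N) x' -> `|S G3 x - S G3 x'| <= e / 2.
  by apply/OSC_leP; apply: hB1 => //; exact: subset_trans B23.
have [N4 N40 N4P] : exists2 N, mu.-negligible N & forall x x',
    (Q `\` N) x -> (Q `\` N) x' -> `|S G4 x - S G4 x'| <= L1 * t.
  apply/OSC_leP; apply: R4_bound => // [x sx|A bA QA].
    by rewrite /G4 restrNE//; apply; exact/Q3/sQ.
  have A0 := ball_measure_gt0 bb bA.
  have QAm := ball_measure_mono bb bQ bA QA.
  apply: (@le_trans _ _ (t * ln 2)%:E).
    rewrite (avg_leP r_ge1 _ (mball bA) (B1_gt0 bb bA) (B1_fin bb bA)); last first.
      by rewrite mulr_ge0 ?ltW.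
    rewrite integral_restr//; apply: (@le_trans _ _ ((t * ln 2) `^ r * m Q)%:E).
      apply: le_trans tail; apply: ge0_subset_integral => //.
      - by apply: measurableI; [exact: mball|exact: measurableC].
      - exact: measurableC.
      - exact: measurable_norm_powR.
    by rewrite lee_fin ler_wpM2l// powR_ge0.
  have rho1 : 1 <= m A / m Q by rewrite ler_pdivlMr// mul1r.
  rewrite lee_fin; apply: ler_wpM2l; first exact: ltW.
  by rewrite ler_ln ?posrE; lra.
have L1t : L1 * t <= e / 2.
  rewrite /t mulrA ler_pdivrMr; last by move: L1_ge0; lra.
  by rewrite mulrDr mulr1 mulrC lerDl ltW.
exists (N1 `|` N2 `|` N3 `|` N4).
  by do !apply: negligibleU.
move=> x x' [Qx nx] [Qx' nx'] /=; rewrite -/c -/F.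
have D z : Q z -> ~ (N1 `|` N2 `|` N3 `|` N4) z ->
    [/\ ~ N1 z, (Q `\` N2) z, (Q `\` N3) z & (Q `\` N4) z].
  move=> Qz nz; split; [move=> ?|split => // ?|split => // ?|split => // ?]; apply: nz.
  - by left; left; left.
  - by left; left; right.
  - by left; right.
  - by right.
have [n1 n2 n3 n4] := D _ Qx nx; have [n1' n2' n3' n4'] := D _ Qx' nx'.
rewrite (N1P _ n1) (N1P _ n1').
have := N2P _ _ n2 n2'; have := N3P _ _ n3 n3'; have := N4P _ _ n4 n4'.
rewrite (_ : _ + _ + _ - _ = (S G2 x - S G2 x') + (S G3 x - S G3 x') +
  (S G4 x - S G4 x')); last first.
  by rewrite !opprD addrACA; congr (_ + _); exact: addrACA.
move=> h4 h3 h2; apply: (le_trans (ler_normD _ _)).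
have := ler_normD (S G2 x - S G2 x') (S G3 x - S G3 x').
by move: h4 h3 h2 L1t; lra.
Unshelve. all: end_near.
Qed.

End restricted_operators.

(** * The sharp maximal function *)

Section maximal_function.
Context {R : realType} {d : measure_display} {X : measurableType d}.
Variables (mu : {measure set X -> \bar R}) (balls : set (set X)) (K r : R).
Hypothesis bb : ball_basis mu balls K.
Context {U : completeNormedModType R}.
Variable f : X -> U.

Lemma sharp_avg_le_maximal B x : balls B -> B x ->
  (sharp_avg mu r f B <= sharp_maximal mu balls r f x)%E.
Proof. by move=> bB Bx; apply: ereal_sup_ubound; exists B. Qed.

Lemma sharp_maximal_ge0 x : (0 <= sharp_maximal mu balls r f x)%E.
Proof.
have [B bB [Bx _]] := B2 bb x x.
by apply: le_trans (sharp_avg_le_maximal bB Bx); exact: poweR_ge0.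
Qed.

(** Superlevel sets are unions of balls, measurable by separability. *)
Lemma measurable_sharp_maximal :
  measurable_fun setT (sharp_maximal mu balls r f).
Proof.
move=> mT; apply: (measurability _ (ErealGenOInfty.measurableE R)) => //.
move=> /= _ [_ [a ->]] <-; rewrite setTI.
rewrite (_ : _ @^-1` _ = \bigcup_(B in [set B | balls B /\
    (a%:E < sharp_avg mu r f B)%E]) B).
  by apply: (ball_separable bb) => B [].
apply/seteqP; split=> [x /=|x [B [bB aB] Bx] /=]; rewrite in_itv/= andbT.
  move=> /ereal_sup_gt[_ [B [bB Bx] <-] aB].
  by exists B.
exact: (lt_le_trans aB (sharp_avg_le_maximal bB Bx)).
Qed.

End maximal_function.

(* The level at which T0 makes the exceptional part of a ball Q smaller than
   mu(Q) / (4 eta K^3). *)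
Definition weak_level (R : realType) (K eta C : R) : R :=
  4 * eta * K ^+ 4 * (C + 1).

(** The first summand is the far part from [tail_oscillation], with [L1 <= C]. The second is the
    local part: the level times the average of the local function, at most [4 * (1 + 2 * K) * s],
    counted at each of two points. *)
Definition osc_constant (R : realType) (K eta C : R) : R :=
  C * (8 / ln 2 * (1 + 4 * eta * K ^+ 2)) +
  weak_level K eta C * (8 * (1 + 2 * K)).

Lemma osc_constant_gt0 (R : realType) (K eta C : R) :
  1 <= K -> 1 < eta -> 0 <= C -> 0 < osc_constant K eta C.
Proof.
move=> K_ge1 eta_gt1 C_ge0; have K_gt0 : 0 < K by lra.
have ln2 : 0 < ln 2 :> R by rewrite ln_gt0// ltr1n.
apply: ltr_wpDl.
  apply: mulr_ge0 => //; apply: mulr_ge0; first by rewrite divr_ge0// ltW.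
  by apply: addr_ge0 => //; apply: mulr_ge0; [lra|exact: sqr_ge0].
apply: mulr_gt0; last by lra.
apply: mulr_gt0; last by lra.
by apply: mulr_gt0; [lra|exact: exprn_gt0].
Qed.

(** * Good sets and reference values for the maximal operator *)

Section maximal_operator.
Context {R : realType} {d : measure_display} {X : measurableType d}.
Variables (mu : {measure set X -> \bar R}) (balls : set (set X)) (K eta r : R).
Hypothesis bb : ball_basis mu balls K.
Hypothesis dbl : doubling mu balls eta.
Hypothesis K_ge1 : 1 <= K.
Hypothesis eta_gt1 : 1 < eta.
Hypothesis r_ge1 : 1 <= r.
Context {U V : completeNormedModType R} {I : Type}.
Variables (T_ : I -> (X -> U) -> X -> V) (T : (X -> U) -> X -> R^o).
Variables (L0 L1 C : R).
Hypothesis T_restricted : uniformly_restricted mu balls r T_ L1.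
Hypothesis T_max : maximal_operator mu r T_ T.
Hypothesis T_weak : T0 mu balls r L0 T.
Hypothesis C_ge : L0 + L1 <= C.
Variable f : X -> U.
Hypothesis Lf : Lr mu r f.
Implicit Types A B E F Q : set X.

Local Notation star := (ball_star mu balls).
Local Notation m A := (fine (mu A)).

Let mball := B1_measurable bb.

Local Notation lam := (weak_level K eta C).
Local Notation Dosc := (osc_constant K eta C).

Let L0_ge0 : 0 <= L0. Proof. by case: T_weak. Qed.
Let L1_ge0 : 0 <= L1. Proof. by case: T_restricted => _ _ _ []. Qed.
Let C_ge0 : 0 <= C. Proof. by move: L0_ge0 L1_ge0 C_ge; lra. Qed.
Let lam_gt0 : 0 < lam.
Proof.
have K0 : 0 < K by move: K_ge1; lra.
rewrite /weak_level !mulr_gt0 ?exprn_gt0//; first by move: eta_gt1; lra.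
by move: C_ge0; lra.
Qed.

(** For [r = 1] the left side is [L0 / (C + 1)]; larger [r] only helps since [L0 / lam <= 1]. The
    fourth power of [K], one more than in [centered], pays for applying T0 on [Q1] instead of
    [Q]. *)
Lemma weak_type_fraction : 4 * eta * K ^+ 4 * (L0 / lam) `^ r <= 1.
Proof.
have K0 : 0 < K by move: K_ge1; lra.
have e0 : 0 < 4 * eta * K ^+ 4.
  by rewrite !mulr_gt0 ?exprn_gt0//; move: eta_gt1; lra.
have C1 : 0 < C + 1 by move: C_ge0; lra.
have h : 4 * eta * K ^+ 4 * (L0 / lam) <= 1.
  rewrite mulrA ler_pdivrMr// mul1r /weak_level ler_wpM2l//; first exact: ltW.
  by move: L1_ge0 C_ge; lra.
have q0 : 0 <= L0 / lam by rewrite divr_ge0// ltW.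
have e1 : 1 <= 4 * eta * K ^+ 4.
  apply: mulr_ege1; last exact: exprn_ege1.
  by move: eta_gt1; lra.
have q1 : L0 / lam <= 1.
  by apply: le_trans h; rewrite ler_peMl.
apply: le_trans h; rewrite ler_wpM2l ?(ltW e0)//.
have [->|qn0] := eqVneq (L0 / lam) 0.
  by rewrite powR0// gt_eqF// (lt_le_trans ltr01).
by apply: ge1r_powR => //; rewrite lt_neqAle eq_sym qn0 q0.
Qed.

(** [E] precedes [s]: the bad set is cut at a multiple of the average [a] of the local part, and [s]
    enters only when [a] is estimated. Cutting with [T] itself gives one set for all [T_ i]. *)
Lemma maximal_operator_oscillation Q : balls Q -> exists E,
  [/\ measurable E, E `<=` Q, 4 * eta * K ^+ 3 * m (Q `\` E) <= m Q
    & forall s : R, 0 < s ->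
      (forall A, balls A -> Q `<=` A -> (sharp_avg mu r f A <= s%:E)%E) ->
      (OSC mu E (T f) <= (Dosc * s)%:E)%E].
Proof.
move=> bQ; have [Q1 [bQ1 sQ QQ1 mQ1]] := ball_starP bb bQ.
have [mQ mQ1'] := (mball bQ, mball bQ1).
have Q1fin := B1_fin bb bQ1.
have [mf fint] := Lf.
have K0 : 0 < K by move: K_ge1; lra.
have Q0 := ball_measure_gt0 bb bQ; have Q10 := ball_measure_gt0 bb bQ1.
pose F := restr (fun x => f x - mean mu f Q) Q1.
have LF : Lr mu r F by exact: Lr_restrB_cst.
have [mg _ _] := T_max LF.
have avg_fin : (avg mu r F Q1 < +oo)%E.
  apply: poweR_lty; apply: lte_mul_pinfty; [by rewrite lee_fin invr_ge0 ltW|by []|].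
  apply: le_lt_trans (proj2 LF); apply: ge0_subset_integral => //.
  exact: measurable_norm_powR (proj1 LF).
have [a aE] : exists a, avg mu r F Q1 = a%:E.
  by exists (fine (avg mu r F Q1)); rewrite fineK// ge0_fin_numE// poweR_ge0.
have a0 : 0 <= a by rewrite -lee_fin -aE poweR_ge0.
pose Bad := [set x | Q1 x /\ ((lam * a)%:E < `|T F x|%:E)%E].
have mBad : measurable Bad.
  rewrite (_ : Bad = Q1 `&` (fun x => lam * a < `|T F x|) @^-1` [set true]).
    apply: measurableI => //; rewrite -[X in measurable X]setTI.
    apply: (@measurable_fun_ltr _ _ _ setT (cst (lam * a)) (fun x => `|T F x|)) => //.
    exact: (measurableT_comp (@normr_measurable R setT)).
  by apply/seteqP; split=> x [Qx h]; split; move: h; rewrite /= ?lte_fin.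
have FQ1 : restr F Q1 = F.
  apply/funext => x; have [Qx|nQ] := pselect (Q1 x); first by rewrite restrE.
  by rewrite restrNE// /F restrNE.
have Bad_le : (mu Bad <= ((L0 / lam) `^ r * m Q1)%:E)%E.
  have [_ /(_ F LF Q1 bQ1 lam lam_gt0)] := T_weak.
  rewrite FQ1 aE -EFinM -/Bad => /le_trans; apply.
  by rewrite EFinM -(ball_measureE bb bQ1).
have Badfin : (mu Bad < +oo)%E by apply: le_lt_trans Bad_le (ltry _).
have mQB : measurable (Q `\` Bad) by exact: measurableD.
exists (Q `\` Bad); split => //.
  have h1 : m (Q `\` (Q `\` Bad)) <= m Bad.
    apply: fine_measure_mono => //; first exact: measurableD.
    by rewrite setDD => x [].
  have h2 : m Bad <= (L0 / lam) `^ r * (K * m Q).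
    have : m Bad <= (L0 / lam) `^ r * m Q1 by rewrite -lee_fin -(fineK_measure Badfin).
    by move=> /le_trans; apply; rewrite ler_wpM2l// powR_ge0.
  have e0 : 0 <= 4 * eta * K ^+ 3.
    by apply: mulr_ge0; [move: eta_gt1; lra|rewrite exprn_ge0// ltW].
  apply: (le_trans (ler_wpM2l e0 (le_trans h1 h2))).
  rewrite [leLHS](_ : _ = 4 * eta * K ^+ 4 * (L0 / lam) `^ r * m Q); last by ring.
  by rewrite ler_piMl ?(ltW Q0)//; exact: weak_type_fraction.
move=> s s0 sA.
have a_le : a <= 4 * (1 + 2 * K) * s.
  have sm c : smeasurable (fun x => f x - c).
    by apply: smeasurableB => //; exact/smeasurable_simple/vsimple_cst.
  have dist : `|mean mu f Q1 - mean mu f Q| <= 2 * K * s.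
    have := mean_dist bb r_ge1 Lf bQ bQ1 QQ1 s0 (sA _ bQ1 QQ1).
    rewrite distrC => h; rewrite -(ler_pM2r Q0); apply: (le_trans h).
    rewrite [leRHS](_ : _ = 2 * s * (K * m Q)); last by ring.
    by rewrite ler_wpM2l// mulr_ge0// ltW.
  rewrite -lee_fin -aE; apply: le_trans.
    apply: (avg_add r_ge1 mQ1' (B1_gt0 bb bQ1) Q1fin (proj1 LF) (sm (mean mu f Q1))
      (ltW s0) (normr_ge0 (mean mu f Q1 - mean mu f Q)) _ (sA _ bQ1 QQ1)).
    move=> x _; apply: (le_trans (norm_restr_le _ _ _)).
    rewrite -[X in `|X| <= _](subrKA (mean mu f Q1)).
    exact: ler_normD.
  by rewrite lee_fin -mulrA ler_wpM2l// mulrDl mul1r lerD2l.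
have D_ge : L1 * (8 / ln 2 * (1 + 4 * eta * K ^+ 2) * s) + 2 * (lam * a) <= Dosc * s.
  have ln2 : 0 < ln 2 :> R by rewrite ln_gt0// ltr1n.
  have D10 : 0 <= 8 / ln 2 * (1 + 4 * eta * K ^+ 2) * s.
    apply: mulr_ge0; last exact: ltW.
    apply: mulr_ge0; first by rewrite divr_ge0// ltW.
    apply: addr_ge0 => //; apply: mulr_ge0; last exact: sqr_ge0.
    by move: eta_gt1; lra.
  have h1 := ler_wpM2r D10 (_ : L1 <= C).
  have h2 := ler_wpM2l (ltW lam_gt0) a_le.
  rewrite /osc_constant [leRHS]mulrDl; apply: lerD.
    by rewrite -[leRHS]mulrA h1//; move: L0_ge0 C_ge; lra.
  by move: h2; rewrite -subr_ge0 => h2; rewrite -subr_ge0; move: h2; nra.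
(* The error [e] of [tail_oscillation] is removed here; [E] depends neither on [e] nor on [i]. *)
apply/lee_addgt0Pr => e e0; rewrite -EFinD.
apply: (@OSC_L0_sup _ _ _ _ I (fun i x => `|T_ i f x|)) => //; first exact: T_max.
move=> i; have [_ Tlin _ [_ T4] T5] := T_restricted.
have T5i (u : U) B (e' : R) : balls B -> 0 < e' ->
    exists B', [/\ balls B', B `<=` B' & forall B'', balls B'' ->
      B' `<=` B'' -> (OSC mu B (T_ i (restr (cst u) B'')) <= e'%:E)%E].
  move=> bB e'0; have [B' [bB' BB' h]] := T5 u B e' bB e'0.
  by exists B'; split => // B'' b'' s''; exact: h.
have [N N0 NP] := tail_oscillation bb dbl K_ge1 eta_gt1 r_ge1 (Tlin i) L1_ge0
  (T4 i) T5i Lf bQ bQ1 sQ s0 e0 sA.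
have [_ /(_ i) [N' [mN' N'0 N'P]] _] := T_max LF.
exists (N `|` N'); first by apply: negligibleU => //; exists N'; split.
move=> x x' [[Qx nBx] nx] [[Qx' nBx'] nx'].
have TFle z : Q z -> ~ Bad z -> ~ (N `|` N') z -> `|T_ i F z| <= lam * a.
  move=> Qz nB nN.
  have h : `|T_ i F z| <= T F z.
    by apply: contrapT => nle; apply: nN; right; apply: N'P.
  apply: (le_trans h); apply: (le_trans (ler_norm _)).
  rewrite leNgt; apply/negP => lt; apply: nB; split; first exact: QQ1.
  by rewrite lte_fin.
have hx := TFle _ Qx nBx nx; have hx' := TFle _ Qx' nBx' nx'.
have := NP x x'; rewrite -/F => /(_ (conj Qx _) (conj Qx' _)).
move=> /(_ (fun h => nx (or_introl h)) (fun h => nx' (or_introl h))) /= hN.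
have : `|T_ i f x| - `|T_ i f x'| <= `|T_ i f x - T_ i f x'| by exact: lerB_dist.
have -> : T_ i f x - T_ i f x' = (T_ i f x - T_ i F x - (T_ i f x' - T_ i F x'))
    + (T_ i F x - T_ i F x').
  by rewrite opprB addrAC !subrKA.
move=> h; have := le_trans h (ler_normD _ _).
have := ler_normB (T_ i F x) (T_ i F x').
by move: hx hx' hN D_ge; lra.
Qed.

(** [OSC] attains its bound off one null set, and [E] has positive measure, so the value of [T f] at
    any remaining point of [E] can serve as [a]. *)
Lemma maximal_operator_centered Q : balls Q -> exists E a,
  centered mu K eta (T f)
    (fun x => Dosc%:E * sharp_maximal mu balls r f x)%E Q E a.
Proof.
move=> bQ; have [E [mE EQ QE oscE]] := maximal_operator_oscillation bQ.
have D_gt0 : 0 < Dosc by exact: osc_constant_gt0.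
have mQ := mball bQ; have Q0 := ball_measure_gt0 bb bQ.
have osc_le y : Q y ->
    (OSC mu E (T f) <= Dosc%:E * sharp_maximal mu balls r f y)%E.
  move=> Qy; have := sharp_maximal_ge0 r bb f y.
  have sA A : balls A -> Q `<=` A ->
      (sharp_avg mu r f A <= sharp_maximal mu balls r f y)%E.
    by move=> bA QA; apply: sharp_avg_le_maximal => //; exact: QA.
  move: sA; case: (sharp_maximal _ _ _ _ _) => [v| |//] sA v0.
    rewrite -EFinM; apply/lee_addgt0Pr => e e0; rewrite -EFinD.
    (* [v] may be 0 while [oscE] asks for a positive level, so [v] is raised slightly. *)
    have De : 0 < e / Dosc by rewrite divr_gt0.
    rewrite lee_fin in v0.
    apply: (le_trans (oscE (v + e / Dosc) _ _)); first lra.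
      move=> A bA QA; apply: (le_trans (sA A bA QA)); rewrite lee_fin; lra.
    by rewrite mulrDr lee_fin lerD2l mulrC divfK// gt_eqF.
  by rewrite gt0_muley ?leey// lte_fin.
have K0 : 0 < K by move: K_ge1; lra.
have QE2 : 2 * m (Q `\` E) <= m Q.
  apply: le_trans QE; rewrite ler_wpM2r ?fine_ge0//.
  have : 1 <= K ^+ 3 by exact: exprn_ege1.
  by move: eta_gt1; nra.
have DE : m Q = m (Q `\` E) + m E.
  by rewrite (fine_measureDI mQ mE (B1_fin bb bQ)) setIC (setIidl EQ).
have Efin := sub_measure_fin mE mQ (B1_fin bb bQ) EQ.
have pick N : mu.-negligible N -> exists x, (E `\` N) x.
  move=> N0; have [||x [Ex _ nN]] := @outside_small_set _ _ _ mu E set0 N mE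
    measurable0 Efin _ N0 _; last by exists x.
  - by rewrite measure0 ltry.
  - by rewrite measure0 /=; move: QE2 DE Q0; lra.
have osc_center (o : R) : (OSC mu E (T f) <= o%:E)%E -> exists2 N,
    mu.-negligible N & exists a, forall x, (E `\` N) x -> `|T f x - a| <= o.
  move=> /OSC_leP[N N0 NP]; exists N => //; have [x0 Ex0] := pick N N0.
  by exists (T f x0) => x Ex; exact: NP.
have : exists2 N, mu.-negligible N & exists a, forall x y, (E `\` N) x -> Q y ->
    (`|T f x - a|%:E <= Dosc%:E * sharp_maximal mu balls r f y)%E.
  (* An oscillation equal to [+oo] forces the weight to be [+oo] on all of [Q], and any [a] will
     do. *)
  case: (OSC mu E (T f)) osc_le osc_center => [b| |] osc_le osc_center.
  - have [//|N N0 [a aP]] := osc_center b.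
    exists N => //; exists a => x y Ex Qy.
    by apply: le_trans (osc_le _ Qy); rewrite lee_fin aP.
  - exists set0; first exact: negligible_set0.
    exists 0 => x y _ Qy; apply: le_trans (osc_le _ Qy).
    by rewrite leey.
  - have [|N N0 [a aP]] := osc_center 0; first by rewrite leNye.
    exists N => //; exists a => x y Ex Qy.
    apply: (@le_trans _ _ 0%E); first by rewrite lee_fin aP.
    apply: mule_ge0; first by rewrite lee_fin ltW.
    exact: (sharp_maximal_ge0 r bb f y).
move=> [N N0 [a aP]]; exists E, a; split => //.
by exists N.
Qed.

End maximal_operator.

Lemma ball_basis_le (R : realType) (d : measure_display) (X : measurableType d)
    (mu : {measure set X -> \bar R}) (balls : set (set X)) (K K' : R) :
  K <= K' -> ball_basis mu balls K -> ball_basis mu balls K'.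
Proof.
move=> KK' [b1 b2 b3 b4 b5 b6 b7]; split => // B bB.
have [B' [bB' BB' mB']] := b6 B bB; exists B'; split => //.
by apply: (le_trans mB'); rewrite lee_wpmul2r// lee_fin.
Qed.

(** The rate must depend on [C]: rescaling the operators rescales [C] and the deviation of [T f]
    alike. *)
Theorem corollary8p3 (R : realType) (K eta r : R) (eta_gt1 : 1 < eta)
    (r_ge1 : 1 <= r) :
  exists2 c' : R, 0 < c' & forall C : R, exists2 c : R, 0 < c &
  forall (d : measure_display) (X : measurableType d)
    (mu : {measure set X -> \bar R}) (balls : set (set X))
    (U V : completeNormedModType R) (I : Type)
    (T_ : I -> (X -> U) -> X -> V) (T : (X -> U) -> X -> R^o) (L0 L1 : R),
  ball_basis mu balls K ->
  doubling mu balls eta ->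
  uniformly_restricted mu balls r T_ L1 ->
  maximal_operator mu r T_ T ->
  T0 mu balls r L0 T ->
  C = L0 + L1 ->
  forall (f : X -> U) (B : set X) (m : R^o) (t : R),
  Lr mu r f -> balls B -> is_median mu (T f) B m -> 0 < t ->
  (mu [set x | B x /\
        (t%:E * sharp_maximal mu balls r f x < `|T f x - m|%:E)%E]
     <= (c' * expR (- (c * t)))%:E * mu B)%E.
Proof.
(* The rate is fixed before any space or operator is given, so [1 <= K] and [0 <= C] are not at hand
   yet: the maximum and the absolute value stand in for them. *)
exists 16 => // C; pose K1 := Num.max 1 K; pose D := osc_constant K1 eta `|C|.
have ln2 : 0 < ln 2 :> R by rewrite ln_gt0// ltr1n.
have K1_ge1 : 1 <= K1 by rewrite le_max lexx.
have D_gt0 : 0 < D by exact: osc_constant_gt0.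
exists (ln 2 / (2 * D)); first by rewrite divr_gt0// mulr_gt0.
move=> d X mu balls U V I T_ T L0 L1 bbK dbl rT mT wT CE f B m t Lf bB med t0.
have bb : ball_basis mu balls K1 by apply: ball_basis_le bbK; rewrite le_max lexx orbT.
have C_ge : L0 + L1 <= `|C| by rewrite -CE ler_norm.
have [mTf _ _] := mT f Lf.
pose w x := (D%:E * sharp_maximal mu balls r f x)%E.
have M0 x := sharp_maximal_ge0 r bb f x.
have mM := measurable_sharp_maximal r bb f.
have mw : measurable_fun setT w by exact: measurable_funeM.
have w0 x : (0 <= w x)%E by apply: mule_ge0 => //; rewrite lee_fin ltW.
have cen := maximal_operator_centered bb dbl K1_ge1 eta_gt1 r_ge1 rT mT wT C_ge Lf.
have dec n := median_deviation bb dbl K1_ge1 eta_gt1 mTf mw w0 n cen bB med.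
have devE s : deviation (T f) (fun x => sharp_maximal mu balls r f x) s B m =
  [set x | B x /\ (s%:E * sharp_maximal mu balls r f x < `|T f x - m|%:E)%E] by [].
have mB := B1_measurable bb bB.
rewrite -devE (ball_measureE bb bB) -EFinM.
set b := fine (mu B); have b0 : 0 <= b by rewrite fine_ge0.
have mdev := deviation_measurable mTf mM t m mB.
(* 16 is 2 to the fourth: 3 for the offset [6 * D] in the level and 1 for rounding [n] down. *)
have exp16 (n : nat) : t / (2 * D) <= n%:R + 4 ->
    2^-1 ^+ n <= 16 * expR (- (ln 2 / (2 * D) * t)).
  move=> tn.
  have E2 k : 2^-1 ^+ k = expR (- (k%:R * ln 2)) :> R.
    by rewrite expRN expRM_natl lnK ?posrE// exprVn.
  have -> : 16 = expR (4%:R * ln 2) :> R.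
    by rewrite expRM_natl lnK ?posrE// -natrX.
  rewrite E2 -expRD ler_expR.
  have : t / (2 * D) * ln 2 <= (n%:R + 4) * ln 2 by rewrite ler_wpM2r// ltW.
  rewrite [X in X <= _](_ : _ = ln 2 / (2 * D) * t); last by ring.
  by lra.
(* Below [t = 6 * D] no [n] is available, but there the claimed bound exceeds [mu B]. *)
have [t3|t3] := leP 3 (t / (2 * D)); last first.
  apply: (@le_trans _ _ (mu B)).
    by apply: measure_mono => //; move=> x [].
  rewrite (ball_measureE bb bB) lee_fin ler_peMl//.
  have := exp16 0%N; rewrite expr0; apply.
  by rewrite add0r; lra.
(* the largest n with (2n + 6) D <= t *)
pose n := Num.truncn (t / (2 * D) - 3).
have n1 : n%:R <= t / (2 * D) - 3 by rewrite truncn_le subr_ge0.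
have n2 : t / (2 * D) - 3 < n.+1%:R := truncnS_gt _.
have nD : (2 * n%:R + 6) * D <= t.
  have : (n%:R + 3) * (2 * D) <= t by rewrite -ler_pdivlMr ?mulr_gt0//; lra.
  by lra.
apply: (@le_trans _ _ (mu (deviation (T f) w (2 * n%:R + 6) B m))).
  apply: measure_mono => //; first exact: deviation_measurable.
  move=> x [Bx dx]; split => //; apply: le_lt_trans dx.
  by rewrite /w muleA -EFinM lee_wpmul2r// lee_fin.
apply: (le_trans (dec n)); rewrite lee_fin ler_wpM2r//.
by apply: exp16; move: n2; rewrite -natr1; lra.
Qed.
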